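(* There exists an infinite-dimensional reflexive Banach space $X$ with an unconditional basis such that, whenever a normalized basic sequence in $X$ has a spreading model $(\tilde x_i)$, the closed linear span $\widetilde X=[\tilde x_i : i\in\mathbb{N}]$ is not isomorphic to $c_0$, is not isomorphic to $\ell_1$, and is not reflexive.
   Context: Banach spaces are real. A seminormalized sequence $(x_i)$ in a Banach space has (generates) the spreading model $(\tilde x_i)$, where $(\tilde x_i)$ is a basic sequence in some Banach space, if for some sequence $\varepsilon_n\searrow 0$ one has, for all $n\in\mathbb{N}$, all $(a_i)_{i=1}^n\in[-1,1]^n$ and all integers $n\le k_1<\dots<k_n$, $$\left|\Big\|\sum_{i=1}^n a_i x_{k_i}\Big\|-\Big\|\sum_{i=1}^n a_i\tilde x_i\Big\|\right|<\varepsilon_n .$$ The closed linear span $\widetilde X=[\tilde x_i:i\in\mathbb{N}]$ is also referred to as the spreading model. *)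

(* Defs.v *)
From HB Require Import structures.
From mathcomp Require Import all_boot all_order all_algebra.
From mathcomp Require Import all_classical all_reals all_analysis.

Set Implicit Arguments.
Unset Strict Implicit.
Unset Printing Implicit Defensive.

Import Order.TTheory GRing.Theory Num.Theory.
Import numFieldNormedType.Exports.

Local Open Scope classical_set_scope.
Local Open Scope ring_scope.

(* Sequences are indexed from 0, so that [x n] is the term usually written
   x_(n+1). *)

Definition sup_norm (R : realType) (T : Type) (A : set T) (f : T -> R^o) : R :=
  sup [set `|f x| | x in A].

Section sup_norm_theory.
Context {R : realType} {T : Type} (A : set T).
Implicit Types f g : T -> R^o.

Definition bounded_over f := has_ubound [set `|f x| | x in A].

Lemma le_sup_norm f x : bounded_over f -> A x -> `|f x| <= sup_norm A f.
Proof. by move=> bf Ax; apply: ub_le_sup => //; exists x. Qed.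

Lemma sup_norm_le f r : A !=set0 -> (forall x, A x -> `|f x| <= r) ->
  sup_norm A f <= r.
Proof.
move=> [x0 Ax0] h; apply: ge_sup; first by exists `|f x0|, x0.
by move=> _ [x Ax <-]; exact: h.
Qed.

Lemma sup_normD f g : A !=set0 -> bounded_over f -> bounded_over g ->
  sup_norm A (f + g) <= sup_norm A f + sup_norm A g.
Proof.
move=> A0 bf bg; apply: sup_norm_le => // x Ax.
by rewrite (le_trans (ler_normD _ _))// lerD// le_sup_norm.
Qed.

Lemma bounded_overZ (a : R) f : bounded_over f -> bounded_over (a *: f).
Proof.
move=> [M hM]; exists (`|a| * M) => _ [x Ax <-].
by rewrite normrZ ler_wpM2l// hM//; exists x.
Qed.

Lemma sup_normZ (a : R) f : A !=set0 -> bounded_over f ->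
  sup_norm A (a *: f) = `|a| * sup_norm A f.
Proof.
move=> A0 bf.
have le b g : bounded_over g -> sup_norm A (b *: g) <= `|b| * sup_norm A g.
  move=> bg; apply: sup_norm_le => // x Ax.
  by rewrite normrZ ler_wpM2l// le_sup_norm.
apply/eqP; rewrite eq_le le//=.
have [->|a0] := eqVneq a 0.
  rewrite normr0 mul0r scale0r.
  case: A0 => x0 Ax0; apply: le_trans (le_sup_norm _ Ax0) => //.
  by exists 0 => _ [x _ <-]; rewrite normr0.
rewrite mulrC -ler_pdivlMr ?normr_gt0// mulrC -normfV.
by rewrite -[in leLHS](scalerK a0 f) le//; exact: bounded_overZ.
Qed.

Lemma sup_norm_eq0 f : bounded_over f -> sup_norm A f = 0 ->
  forall x, A x -> f x = 0.
Proof.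
move=> bf f0 x Ax; apply/eqP; rewrite -normr_le0 -f0.
exact: le_sup_norm.
Qed.
End sup_norm_theory.

Section dual_space.
Context {R : realType} (X : normedModType R).

Definition is_functional : {pred X -> R^o} :=
  [pred f : X -> R^o | `[< linear f /\ continuous f >]].

Lemma is_functional_submod : submod_closed is_functional.
Proof.
split.
  apply/asboolP; split; last by move=> x; exact: cvg_cst.
  by move=> a u v; rewrite /= scaler0 addr0.
move=> a f g /asboolP[lf cf] /asboolP[lg cg]; apply/asboolP; split.
  move=> b u v; rewrite /= !fctE lf lg.
  by rewrite !scalerDr !scalerA [a * b]mulrC addrACA.
move=> u; apply: continuousD; last exact: cg.
by apply: continuousZl_tmp; exact: cf.
Qed.

HB.instance Definition _ :=
  GRing.isSubmodClosed.Build _ _ is_functional is_functional_submod.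

Record dual := Dual { dual_fun :> X -> R^o ; _ : dual_fun \in is_functional }.

HB.instance Definition _ := [isSub for dual_fun].
HB.instance Definition _ := [Choice of dual by <:].
HB.instance Definition _ := [SubChoice_isSubLmodule of dual by <:].

Let unit_ball : set X := [set x | `|x| <= 1].

Let unit_ball0 : unit_ball !=set0.
Proof. by exists 0; rewrite /unit_ball/= normr0. Qed.

Lemma dual_linear (f : dual) : linear f.
Proof. by case: f => f /= /asboolP[]. Qed.

Lemma dual_continuous (f : dual) : continuous f.
Proof. by case: f => f /= /asboolP[]. Qed.

Lemma dual_bounded (f : dual) : bounded_over unit_ball f.
Proof.
pose fL := HB.pack_for {linear X -> R^o} (f : X -> R^o)
  (GRing.isLinear.Build R X R^o _ (f : X -> R^o) (dual_linear f)).
have /bounded_funP /(_ 1)[M hM] : bounded_near fL (nbhs (0 : X)).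
  by apply/linear_bounded_continuous; exact: (@dual_continuous f).
by exists M => _ [x x1 <-]; exact: hM.
Qed.

Definition dual_norm (f : dual) : R := sup_norm unit_ball f.

Lemma dual_normD f g : dual_norm (f + g) <= dual_norm f + dual_norm g.
Proof. by apply: sup_normD => //; exact: dual_bounded. Qed.

Lemma dual_normZ a f : dual_norm (a *: f) = `|a| * dual_norm f.
Proof. by apply: sup_normZ => //; exact: dual_bounded. Qed.

Lemma dual_norm_eq0 f : dual_norm f = 0 -> f = 0.
Proof.
move=> f0; apply/val_inj/funext => x /=.
have [->|x0] := eqVneq x 0.
  by have := dual_linear f (-1) 0 0; rewrite scaler0 addr0 scaleN1r addNr.
have h : f (`|x|^-1 *: x) = 0.
  apply: (sup_norm_eq0 (dual_bounded f) f0).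
  by rewrite /unit_ball/= normfZV.
have := dual_linear f `|x|^-1 x 0.
rewrite addr0 h.
have -> : f 0 = 0.
  by have := dual_linear f (-1) 0 0; rewrite scaler0 addr0 scaleN1r addNr.
rewrite addr0 => /esym/eqP; rewrite scaler_eq0 invr_eq0 normr_eq0 (negbTE x0).
by move=> /eqP.
Qed.

HB.instance Definition _ := @Lmodule_isNormed.Build R dual
  dual_norm dual_normD dual_normZ dual_norm_eq0.

End dual_space.

(* Every element of the bidual is the evaluation at a point, i.e. the canonical
   embedding of X in its bidual is onto. *)
Definition reflexive_space (R : realType) (X : normedModType R) :=
  forall Phi : dual (dual X), exists x : X, forall f : dual X, Phi f = f x.

Definition isomorphic (R : realType) (X Y : normedModType R) :=
  exists (T : {linear X -> Y}) (S : {linear Y -> X}),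
    [/\ continuous T, continuous S, cancel T S & cancel S T].

Definition infinite_dimensional (R : realType) (X : lmodType R) :=
  forall (n : nat) (v : 'I_n -> X),
    exists x : X, forall a : 'I_n -> R, x <> \sum_(i < n) a i *: v i.

Section c0_space.
Variable R : realType.

Definition is_c0 : {pred nat -> R^o} :=
  [pred u : nat -> R^o | `[< u @ \oo --> (0 : R^o) >]].

Lemma is_c0_submod : submod_closed is_c0.
Proof.
split; first by apply/asboolP; exact: cvg_cst.
move=> a u v /asboolP cu /asboolP cv; apply/asboolP.
by rewrite -[0](addr0 (0 : R^o)) -{1}(scaler0 R^o a); apply: cvgD => //; exact: cvgZl_tmp.
Qed.

HB.instance Definition _ :=
  GRing.isSubmodClosed.Build _ _ is_c0 is_c0_submod.

Record c0 := C0 { c0_seq :> nat -> R^o ; _ : c0_seq \in is_c0 }.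

HB.instance Definition _ := [isSub for c0_seq].
HB.instance Definition _ := [Choice of c0 by <:].
HB.instance Definition _ := [SubChoice_isSubLmodule of c0 by <:].

Lemma c0_bounded (u : c0) : bounded_over setT u.
Proof.
case: u => u /= /asboolP cu.
have /cvg_seq_bounded[M [_ hM]] : cvgn u by apply/cvg_ex; exists 0.
exists (M + 1) => _ [n _ <-]; apply: hM => //.
by rewrite ltrDl.
Qed.

Definition c0_norm (u : c0) : R := sup_norm setT u.

Lemma c0_normD u v : c0_norm (u + v) <= c0_norm u + c0_norm v.
Proof. by apply: sup_normD; [exists 0%N|exact: c0_bounded..]. Qed.

Lemma c0_normZ a u : c0_norm (a *: u) = `|a| * c0_norm u.
Proof. by apply: sup_normZ; [exists 0%N|exact: c0_bounded]. Qed.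

Lemma c0_norm_eq0 u : c0_norm u = 0 -> u = 0.
Proof.
move=> u0; apply/val_inj/funext => n.
exact: (sup_norm_eq0 (c0_bounded u) u0).
Qed.

HB.instance Definition _ := @Lmodule_isNormed.Build R c0
  c0_norm c0_normD c0_normZ c0_norm_eq0.
End c0_space.

Section l1_space.
Variable R : realType.

Definition is_l1 : {pred nat -> R^o} :=
  [pred u : nat -> R^o | `[< cvgn (series (fun n => `|u n|)) >]].

Lemma is_l1_submod : submod_closed is_l1.
Proof.
split.
  apply/asboolP; rewrite (_ : series _ = cst 0); first exact: is_cvg_cst.
  apply/funext => n; rewrite /series/= big1// => i _; exact: normr0.
move=> a u v /asboolP cu /asboolP cv; apply/asboolP.
apply: (@series_le_cvg _ _ (fun n => `|a| * `|u n| + `|v n|)).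
- by move=> n; exact: normr_ge0.
- by move=> n; rewrite addr_ge0// mulr_ge0.
- by move=> n; rewrite (le_trans (ler_normD _ _))// lerD// normrZ.
- rewrite [X in cvgn X](_ : _ = `|a| *: series (fun n => `|u n|) + series (fun n => `|v n|)).
    by apply: is_cvgD => //; apply: is_cvgZl_tmp.
  apply/funext => n; rewrite /series/= !fctE big_split/= -mulr_sumr.
  by [].
Qed.

HB.instance Definition _ :=
  GRing.isSubmodClosed.Build _ _ is_l1 is_l1_submod.

Record l1 := L1 { l1_seq :> nat -> R^o ; _ : l1_seq \in is_l1 }.

HB.instance Definition _ := [isSub for l1_seq].
HB.instance Definition _ := [Choice of l1 by <:].
HB.instance Definition _ := [SubChoice_isSubLmodule of l1 by <:].

Lemma l1_summable (u : l1) : cvgn (series (fun n => `|u n|)).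
Proof. by case: u => u /= /asboolP. Qed.

Definition l1_norm (u : l1) : R := limn (series (fun n => `|u n|)).

Lemma l1_normD u v : l1_norm (u + v) <= l1_norm u + l1_norm v.
Proof.
rewrite /l1_norm -limD; [|exact: l1_summable..].
apply: ler_lim; [exact: l1_summable| |].
  by apply: is_cvgD; exact: l1_summable.
near=> n; rewrite /series/= !fctE -big_split/=; apply: ler_sum => i _.
exact: ler_normD.
Unshelve. all: by end_near. Qed.

Lemma l1_normZ a u : l1_norm (a *: u) = `|a| * l1_norm u.
Proof.
rewrite /l1_norm (_ : series _ = `|a| *: series (fun n => `|u n|)).
  by apply/cvg_lim => //; apply: cvgZl_tmp; exact: l1_summable.
apply/funext => n; rewrite /series/= !fctE scaler_sumr.
by apply: eq_bigr => i _; rewrite /= normrZ.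
Qed.

Lemma l1_norm_eq0 u : l1_norm u = 0 -> u = 0.
Proof.
move=> u0; apply/val_inj/funext => n; apply/eqP; rewrite -normr_le0 -u0.
apply: (@le_trans _ _ (series (fun n => `|u n|) n.+1)).
  by rewrite /series/= big_nat_recr//= lerDr sumr_ge0.
apply: nondecreasing_cvgn_le; last exact: l1_summable.
by apply/nondecreasing_seqP => m; rewrite /series/= big_nat_recr//= lerDl.
Qed.

HB.instance Definition _ := @Lmodule_isNormed.Build R l1
  l1_norm l1_normD l1_normZ l1_norm_eq0.
End l1_space.

Section closed_span.
Context {R : realType} {X : normedModType R} (x : nat -> X).

Definition lin_span : set X :=
  [set v | exists (n : nat) (a : nat -> R), v = \sum_(i < n) a i *: x i].

Definition in_closed_span : {pred X} := [pred v | `[< closure lin_span v >]].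

Lemma lin_span_submod (a : R) u v :
  lin_span u -> lin_span v -> lin_span (a *: u + v).
Proof.
move=> [m [b ->]] [n [c ->]].
have ext k p (d : nat -> R) : \sum_(i < k) d i *: x i =
    \sum_(i < k + p) (if (i < k)%N then d i else 0) *: x i.
  rewrite big_split_ord/= [X in _ + X]big1 ?addr0; last first.
    by move=> i _; rewrite ltnNge leq_addr/= scale0r.
  by apply: eq_bigr => i _; rewrite ltn_ord.
exists (m + n)%N.
exists (fun i => a * (if (i < m)%N then b i else 0) +
                 if (i < n)%N then c i else 0).
rewrite (ext m n b) (ext n m c) (addnC n m) scaler_sumr -big_split/=.
by apply: eq_bigr => i _; rewrite scalerDl scalerA.
Qed.

Lemma in_closed_span_submod : submod_closed in_closed_span.
Proof.
split.
  apply/asboolP/subset_closure; exists 0%N, (fun=> 0).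
  by rewrite big_ord0.
move=> a u v /asboolP cu /asboolP cv; apply/asboolP => B nB.
have /= : (fun z : X * X => a *: z.1 + z.2) @ (nbhs u, nbhs v) --> a *: u + v.
  apply: (@cvgD _ _ _ _ _ (fun z : X * X => a *: z.1) (fun z => z.2)).
    by apply: cvgZl_tmp; exact: cvg_fst.
  exact: cvg_snd.
move=> /(_ B nB)[[P Q]/= [nP nQ] PQB].
have [u' [su' Pu']] := cu _ nP; have [v' [sv' Qv']] := cv _ nQ.
exists (a *: u' + v'); split; first exact: lin_span_submod.
by apply: (PQB (u', v')).
Qed.

HB.instance Definition _ :=
  GRing.isSubmodClosed.Build _ _ in_closed_span in_closed_span_submod.

Record closed_span :=
  ClosedSpan { closed_span_val :> X ; _ : closed_span_val \in in_closed_span }.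

HB.instance Definition _ := [isSub for closed_span_val].
HB.instance Definition _ := [Choice of closed_span by <:].
HB.instance Definition _ := [SubChoice_isSubLmodule of closed_span by <:].

Definition closed_span_norm (v : closed_span) : R := `|val v|.

Lemma closed_span_normD u v :
  closed_span_norm (u + v) <= closed_span_norm u + closed_span_norm v.
Proof. exact: ler_normD. Qed.

Lemma closed_span_normZ a u :
  closed_span_norm (a *: u) = `|a| * closed_span_norm u.
Proof. exact: normrZ. Qed.

Lemma closed_span_norm_eq0 u : closed_span_norm u = 0 -> u = 0.
Proof. by move=> u0; apply/val_inj/normr0_eq0. Qed.

HB.instance Definition _ := @Lmodule_isNormed.Build R closed_span
  closed_span_norm closed_span_normD closed_span_normZ closed_span_norm_eq0.
End closed_span.

Section closed_span_complete.
Context {R : realType} {X : completeNormedModType R} (x : nat -> X).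

Lemma closed_span_cauchy_cvg (F : set_system (closed_span x)) :
  ProperFilter F -> cauchy F -> cvg F.
Proof.
move=> FF /cauchyP cF.
have : cauchy ((val : closed_span x -> X) @ F).
  apply/cauchyP => e /cF[v]; rewrite -ball_normE => Fv; exists (val v).
  by rewrite -ball_normE.
move=> /cauchy_cvg /cvg_ex[l Fl].
have cl : closure (lin_span x) l.
  apply: (@closed_cvg _ _ F _ val) Fl; first exact: closed_closure.
  by apply: nearW => -[v /= /asboolP].
apply/cvg_ex; exists (ClosedSpan (asboolT cl : l \in in_closed_span x)).
apply/cvgrPdist_lt => e e0; move/cvgrPdist_lt : Fl => /(_ e e0).
by [].
Qed.

HB.instance Definition _ :=
  Uniform_isComplete.Build (closed_span x) closed_span_cauchy_cvg.
End closed_span_complete.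

Section bases.
Context {R : realType} {X : normedModType R}.
Implicit Types e x : nat -> X.

Definition schauder_basis_of (V : set X) e :=
  (forall n, V (e n)) /\
  forall v, V v ->
    exists! a : nat -> R, series (fun n => a n *: e n) @ \oo --> v.

Definition schauder_basis e := schauder_basis_of setT e.

Definition basic_sequence x := schauder_basis_of (closure (lin_span x)) x.

Definition unconditionally_convergent (u : nat -> X) :=
  forall s : nat -> nat, bijective s -> cvgn (series (u \o s)).

Definition unconditional_basis e :=
  schauder_basis e /\
  forall a : nat -> R, cvgn (series (fun n => a n *: e n)) ->
    unconditionally_convergent (fun n => a n *: e n).

Definition normalized x := forall n, `|x n| = 1.

Definition seminormalized x :=
  exists c C : R, 0 < c /\ forall n, c <= `|x n| <= C.

End bases.

(* Since x is indexed from 0, the condition n <= k_1 reads n <= (k i).+1. *)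
Definition generates_spreading_model (R : realType) (X Y : normedModType R)
    (x : nat -> X) (y : nat -> Y) :=
  [/\ seminormalized x, basic_sequence y &
    exists eps : nat -> R,
      [/\ nonincreasing_seq eps, eps @ \oo --> (0 : R) &
        forall (n : nat) (a : 'I_n -> R) (k : 'I_n -> nat),
          (0 < n)%N -> (forall i, -1 <= a i <= 1) ->
          (forall i, (n <= (k i).+1)%N) ->
          {homo k : i j / (i < j)%N} ->
          `| `|\sum_(i < n) a i *: x (k i)| - `|\sum_(i < n) a i *: y i| |
            < eps n]].

(* Main.v *)
From HB Require Import structures.
Require Import Defs.
From mathcomp Require Import all_boot all_order all_algebra.
From mathcomp Require Import all_classical all_reals all_analysis.
From mathcomp Require Import ring lra zify.

(** The space is a Tsirelson-type space whose norm satisfies the implicit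
    equation
      |x| = max (|x|_oo, sup_p sum_(k < p) 2^-(k+4) sup sum_(j < 2^(k^2)) |E_j x|)
    where, for each layer k, the inner supremum is over successive intervals
    E_0 < E_1 < ... of [p, +oo[.  Two features matter.  The layers are added
    instead of being competing candidates for the norm, and only the layers
    below p may be used, on the part of x that lies beyond p.

    Because the layers are added, a vector of norm at most 1 which is supported
    far out has layer norms whose sum over any set of early layers is at most 1.
    Suppose that sums of m terms of a block sequence had norm almost m.  In such
    a sum the low layers contribute little: a layer with few intervals sees
    most terms at most once, times its small weight.  The parameter p of a functional that norms the sum
    is bounded as soon as the first half of the sum is fixed, however far the
    second half is, so the terms of the second half are normed by layers in a
    window [K, B[ that depends on K only.  Five successive windows then
    contradict the norm being at most 1; this is [no_flat_blocks].  It shows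
    that the unit vector basis is shrinking ([mixed_shrinking]) and that the sums
    of N terms of a spreading model are o(N) ([sum_norm_sublinear]).  The basis is
    boundedly complete because the number of intervals of a layer is huge
    compared with the inverse of its weight ([mixed_tail]), and reflexivity follows.

    The same window argument produces l1 inside every spreading model.  The
    number of intervals grows faster than every power of the inverse of the
    weight, so the norm
    of the sum of N terms cannot decay polynomially relative to N, and there
    are arbitrarily long ranges on which it is almost linear.  The average over
    such a range is not normed by the layers below a given K, hence its second
    half is normed by the layers of a window [K, B[ ([normed_window]).  Averages
    with successive windows are normed simultaneously by one functional of the
    norming set, once they are realised far enough in the space; so they span l1
    in the spreading model ([block_model_l1_like]), which cannot be reflexive
    ([reflexive_no_l1]).

    Finally, in c0 some alternating sums of N terms of a bounded sequence stay
    bounded, while in l1 they grow linearly if the sequence is separated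
    ([c0_chain], [l1_chain]).  In the spreading model all the alternating sums of
    N terms have the same norm, which is unbounded and o(N).  Differences of
    terms are used throughout because, in the original sequence, they may be
    chosen small on any given finite set of coordinates: they are close to
    blocks even when the sequence is not known to be weakly null. *)

Set Implicit Arguments.
Unset Strict Implicit.
Unset Printing Implicit Defensive.

Import Order.TTheory GRing.Theory Num.Theory.
Import numFieldNormedType.Exports.

Local Open Scope classical_set_scope.
Local Open Scope ring_scope.

(** * The norming set *)

Section norming_set.
Context {R : realType}.
Implicit Types (f x y : nat -> R) (c : nat -> nat -> nat)
  (g : nat -> nat -> nat -> R).

Definition weight (k : nat) : R := 2^-1 ^+ (k + 4).

Definition pieces (k : nat) : nat := (2 ^ (k ^ 2))%N.

(** The functional that uses the layers [a <= k < b], with cut points [c k] for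
    layer [k] and norming functionals [g k j] on its intervals.  Cut points
    encode successive intervals without any side condition on supports. *)
Definition layers (a b : nat) c g (i : nat) : R :=
  \sum_(a <= k < b) weight k *
    \sum_(j < pieces k) (c k j <= i < c k j.+1)%N%:R * g k j i.

(** Only nonnegative functionals are generated; they are paired with absolute
    values, which makes the basis 1-unconditional by construction. *)
Inductive norming : (nat -> R) -> Prop :=
| norming_unit (i : nat) : norming (fun j => (j == i)%:R)
| norming_op (p : nat) c g : (forall k, {homo c k : i j / (i <= j)%N}) ->
    (forall k j, norming (g k j)) ->
    norming (fun i => (p <= i)%N%:R * layers 0 p c g i).

Definition admissible c g :=
  (forall k, {homo c k : i j / (i <= j)%N}) /\ forall k j, norming (g k j).

Lemma weight_gt0 k : 0 < weight k. Proof. by rewrite exprn_gt0. Qed.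

Lemma weight_ge0 k : 0 <= weight k. Proof. exact/ltW/weight_gt0. Qed.

(** The bound 1/8 is what keeps a sum that is covered by one interval in each
    layer from being normed. *)
Lemma sum_weight_le a b : \sum_(a <= k < b) weight k <= 8^-1.
Proof.
have sum0 n : \sum_(0 <= k < n) weight k = 8^-1 - 2 * weight n.
  elim: n => [|n IH]; first by rewrite big_geq// /weight; field.
  by rewrite big_nat_recr//= IH /weight addSn exprS; field.
have le0 n : \sum_(0 <= k < n) weight k <= 8^-1.
  by rewrite sum0 gerBl mulr_ge0// weight_ge0.
have [ab|ba] := leqP a b; last by rewrite big_geq ?invr_ge0// ltnW.
apply: le_trans (le0 b); rewrite [leRHS](@big_cat_nat _ _ _ a)//=.
by rewrite lerDr sumr_ge0// => k _; exact: weight_ge0.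
Qed.

Lemma sum_cut_le1 (c : nat -> nat) (m i : nat) : {homo c : i j / (i <= j)%N} ->
  \sum_(j < m) (c j <= i < c j.+1)%N%:R <= 1 :> R.
Proof.
move=> ch; suff h : \sum_(j < m) (c j <= i < c j.+1)%N%:R <= (i < c m)%N%:R :> R.
  by rewrite (le_trans h)// lern1 leq_b1.
elim: m => [|m IH]; first by rewrite big_ord0.
rewrite big_ord_recr/=; apply: le_trans (lerD IH (lexx _)) _.
have cm := ch m m.+1 (leqnSn m).
rewrite -natrD ler_nat; lia.
Qed.

Lemma layers_ge0 a b c g i : (forall k j, 0 <= g k j i) -> 0 <= layers a b c g i.
Proof.
move=> g0; apply: sumr_ge0 => k _; rewrite mulr_ge0 ?weight_ge0//.
by apply: sumr_ge0 => j _; rewrite mulr_ge0.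
Qed.

Lemma norming_ge0 f i : norming f -> 0 <= f i.
Proof.
move=> Wf; elim: Wf i => [i j|p c g _ _ IH i]; first exact: ler0n.
by rewrite mulr_ge0// layers_ge0.
Qed.

Lemma norming_le1 f i : norming f -> f i <= 1.
Proof.
move=> Wf; elim: Wf i => [i j|p c g hc Wg IH i]; first by rewrite lern1 leq_b1.
suff h : layers 0 p c g i <= 1.
  have l0 : 0 <= layers 0 p c g i by apply: layers_ge0 => k j; exact: norming_ge0.
  by case: (p <= i)%N; rewrite ?mul1r ?mul0r.
apply: (@le_trans _ _ (\sum_(0 <= k < p) weight k)); last first.
  by rewrite (le_trans (sum_weight_le _ _))// invf_le1// ler1n.
apply: ler_sum => k _; rewrite ler_piMr ?weight_ge0//.
apply: le_trans (sum_cut_le1 (pieces k) i (hc k)).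
by apply: ler_sum => j _; rewrite ler_piMr.
Qed.

(** The assertion that the norm is at most [r], usable for arbitrary sequences
    before the space, or the finiteness of the norm, is available. *)
Definition normle x (r : R) :=
  forall f n, norming f -> \sum_(i < n) f i * `|x i| <= r.

Lemma normle_ge0 x r : normle x r -> 0 <= r.
Proof. by move=> /(_ _ 0%N (norming_unit 0)); rewrite big_ord0. Qed.

Lemma normle_coord x r i : normle x r -> `|x i| <= r.
Proof.
move=> /(_ _ i.+1 (norming_unit i)); apply: le_trans.
rewrite big_ord_recr/= eqxx mul1r lerDr sumr_ge0// => j _.
Qed.

Lemma normle_dom x y r : (forall i, `|x i| <= `|y i|) ->
  normle y r -> normle x r.
Proof.
move=> xy yr f n Wf; apply: le_trans (yr f n Wf); apply: ler_sum => i _.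
by rewrite ler_wpM2l// norming_ge0.
Qed.

Lemma normle_le x r r' : r <= r' -> normle x r -> normle x r'.
Proof. by move=> rr' xr f n Wf; exact: le_trans (xr f n Wf) rr'. Qed.

Lemma normleD x y r s : normle x r -> normle y s ->
  normle (fun i => x i + y i) (r + s).
Proof.
move=> xr ys f n Wf.
apply: (le_trans _ (lerD (xr f n Wf) (ys f n Wf))).
rewrite -big_split/=; apply: ler_sum => i _.
by rewrite -mulrDr ler_wpM2l ?norming_ge0// ler_normD.
Qed.

Lemma normleZ (a : R) x r : normle x r -> normle (fun i => a * x i) (`|a| * r).
Proof.
move=> xr f n Wf.
apply: (le_trans _ (ler_wpM2l (normr_ge0 a) (xr f n Wf))).
rewrite mulr_sumr; apply: ler_sum => i _.
by rewrite normrM mulrCA.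
Qed.

Lemma sum_nonneg_mono (h : nat -> R) m n : (forall i, 0 <= h i) ->
  (m <= n)%N -> \sum_(i < m) h i <= \sum_(i < n) h i.
Proof.
move=> h0 mn; rewrite -!(big_mkord xpredT) [leRHS](@big_cat_nat _ _ _ m)//=.
by rewrite lerDl sumr_ge0.
Qed.

Lemma layers_pair a b c g x n :
  \sum_(i < n) layers a b c g i * x i =
  \sum_(a <= k < b) weight k * \sum_(j < pieces k)
     \sum_(i < n) g k j i * ((c k j <= i < c k j.+1)%N%:R * x i).
Proof.
under eq_bigr do rewrite mulr_suml.
rewrite exchange_big/=; apply: eq_bigr => k _.
rewrite exchange_big/= mulr_sumr; apply: eq_bigr => i _.
rewrite -mulrA; congr (_ * _).
by rewrite mulr_suml; apply: eq_bigr => j _; rewrite [in RHS]mulrCA mulrA.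
Qed.

End norming_set.

(** * Estimates for layers *)

Section layer_estimates.
Context {R : realType}.
Implicit Types (f x : nat -> R) (y : nat -> nat -> R) (c : nat -> nat -> nat)
  (g : nat -> nat -> nat -> R).

Lemma not_normle x r : ~ normle x r ->
  exists f n, norming f /\ r < \sum_(i < n) f i * `|x i|.
Proof.
move=> xr; apply: contrapT => h; apply: xr => f n Wf.
by rewrite leNgt; apply/negP => rf; apply: h; exists f, n.
Qed.

Lemma admissible0 : admissible (fun _ _ => 0%N) (fun _ _ j => (j == 0%N)%:R : R).
Proof. by split=> // k j; exact: norming_unit. Qed.

Lemma layers_const a b g i : layers a b (fun _ _ => 0%N) g i = 0 :> R.
Proof.
rewrite /layers big1// => k _; rewrite big1 ?mulr0// => j _.
by rewrite ltn0 mul0r.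
Qed.

Lemma layers_cat a m b c1 g1 c2 g2 : admissible c1 g1 -> admissible c2 g2 ->
  (a <= m <= b)%N -> exists c g, admissible c g /\
  forall i, layers a b c g i = layers a m c1 g1 i + layers m b c2 g2 i :> R.
Proof.
move=> [h1 W1] [h2 W2] /andP[am mb].
exists (fun k => if (k < m)%N then c1 k else c2 k),
  (fun k => if (k < m)%N then g1 k else g2 k); split.
  by split=> k; case: ifP.
move=> i; rewrite /layers (@big_cat_nat _ _ _ m)//=; congr (_ + _);
  apply: eq_big_nat => k /andP[k1 k2].
  by rewrite k2.
by rewrite ltnNge k1.
Qed.

Lemma layers_pad a b c g : admissible c g -> (a <= b)%N ->
  exists c' g', admissible c' g' /\ forall i, layers 0 b c' g' i = layers a b c g i :> R.
Proof.
move=> cg ab.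
have [|c' [g' [a' e]]] := @layers_cat 0 a b _ _ _ _ admissible0 cg; first by rewrite ab.
by exists c', g'; split=> // i; rewrite e layers_const add0r.
Qed.

(** On vectors supported beyond [b] the restriction in the definition of the norming
    set is harmless: every functional using the layers below [b] is norming there. *)
Lemma layers_far_le a b c g x r n : admissible c g ->
  (forall i, x i != 0 -> (b <= i)%N) -> normle x r ->
  \sum_(i < n) layers a b c g i * `|x i| <= r.
Proof.
move=> cg xb xr.
have [ab|ba] := leqP a b; last first.
  rewrite big1 ?(normle_ge0 xr)// => i _.
  by rewrite /layers big_geq ?mul0r// ltnW.
have [c' [g' [[hc' Wg'] e]]] := layers_pad cg ab.
apply: le_trans (xr _ n (norming_op b hc' Wg')); apply: ler_sum => i _.
rewrite e; have [->|/xb ->] := eqVneq (x i) 0; first by rewrite normr0 !mulr0.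
by rewrite mul1r.
Qed.

(** Functionals that almost norm consecutive pieces are assembled into one layer; the
    parameter [K.+1] makes layer [K] available beyond [c 0]. *)
Lemma layer_lower K (c : nat -> nat) x s r :
  {homo c : i j / (i <= j)%N} -> (K < c 0)%N ->
  (forall j, (j < pieces K)%N -> ~ normle (fun i => (c j <= i < c j.+1)%N%:R * x i) s) ->
  normle x r -> weight K * (pieces K)%:R * s <= r.
Proof.
move=> hc Kc h xr.
have /choice[fn Hfn] (j : nat) : exists fn : (nat -> R) * nat, norming fn.1 /\ ((j < pieces K)%N ->
    s < \sum_(i < fn.2) fn.1 i * `|(c j <= i < c j.+1)%N%:R * x i|).
  have [jK|_] := ltnP j (pieces K); last by exists (fun j => (j == 0%N)%:R, 0%N); split=> //; exact: norming_unit.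
  by have [f [n [Wf sf]]] := not_normle (h j jK); exists (f, n).
pose n := (\max_(j < pieces K) (fn j).2)%N.
pose x' i := (K < i)%N%:R * x i.
have x'r : normle x' r.
  apply: normle_dom xr => i; rewrite /x' normrM.
  by rewrite ler_piMl// normr_nat lern1 leq_b1.
have acg : admissible (fun=> c) (fun _ j => (fn j).1).
  by split=> // k j; have [] := Hfn j.
have x'K i : x' i != 0 -> (K < i)%N.
  by rewrite /x'; case: (K < i)%N => //; rewrite mul0r eqxx.
apply: le_trans (layers_far_le K n acg x'K x'r).
rewrite (layers_pair K K.+1 _ _ (fun i => `|x' i|) n) big_nat1 -mulrA ler_pM2l ?weight_gt0//.
rewrite mulr_natl -[in leLHS](card_ord (pieces K)) -sumr_const.
apply: ler_sum => j _; apply: le_trans (ltW ((Hfn j).2 (ltn_ord j))) _.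
have jn : ((fn j).2 <= n)%N by exact: (leq_bigmax j).
apply: (@le_trans _ _ (\sum_(i < n) (fn j).1 i * `|(c j <= i < c j.+1)%N%:R * x i|)).
  apply: (@sum_nonneg_mono _ (fun i => (fn j).1 i * `|(c j <= i < c j.+1)%N%:R * x i|)) => // i.
  by rewrite mulr_ge0//; apply: norming_ge0; have [] := Hfn j.
apply: ler_sum => i _; rewrite ler_wpM2l//; first by apply: norming_ge0; have [] := Hfn j.
rewrite normrM normr_nat /x'.
have [/andP[cji _]|_] := boolP (c j <= i < c j.+1)%N; last by rewrite !mul0r.
have -> : (K < i)%N by apply: leq_trans Kc (leq_trans _ cji); exact: hc.
by rewrite !mul1r.
Qed.

Definition blocks (sg : nat -> nat) y :=
  {homo sg : i j / (i <= j)%N} /\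
  forall l i, 0 <= y l i /\ (y l i != 0 -> (sg l <= i < sg l.+1)%N).

(** An interval splits at most one block that starts before it, so up to one block
    per interval the intervals of a layer only partition the sum.  If sums of
    blocks have norm at most affine in the number of terms, each layer therefore
    sees at most the whole sum plus a bounded error per interval, times its weight. *)
Lemma layers_upper K c g sg y M (al be : R) n : admissible c g -> blocks sg y ->
  0 <= al -> 0 <= be ->
  (forall A : {set 'I_M}, normle (fun i => \sum_(l in A) y l i) (al * #|A|%:R + be)) ->
  \sum_(i < n) layers 0 K c g i * (\sum_(l < M) y l i) <=
  8^-1 * (al * M%:R + (pieces K)%:R * (al + be)).
Proof.
move=> [hc Wg] [hs hy] al0 be0 hA.
set C := al * M%:R + _.
have C0 : 0 <= C by rewrite addr_ge0// mulr_ge0// addr_ge0.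
rewrite (layers_pair 0 K c g (fun i => \sum_(l < M) y l i) n).
apply: (@le_trans _ _ (\sum_(0 <= k < K) weight k * C)); last first.
  by rewrite -mulr_suml ler_wpM2r// sum_weight_le.
apply: ler_sum_nat => k /andP[_ kK]; rewrite ler_wpM2l ?weight_ge0//.
(* [A j] collects the blocks that start in the j-th interval, [B j] the block
   that the beginning of this interval cuts. *)
pose A j : {set 'I_M} := finset (fun l : 'I_M => (c k j <= sg l < c k j.+1)%N).
pose B j : {set 'I_M} := finset (fun l : 'I_M => (sg l < c k j < sg l.+1)%N).
have cardB j : (#|B j| <= 1)%N.
  apply/card_le1_eqP => l l'; rewrite !inE => /andP[h1 h2] /andP[h3 h4].
  apply/val_inj/eqP; rewrite /= eqn_leq; apply/andP; split; rewrite leqNgt; apply/negP => ll.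
    by have := hs _ _ ll; lia.
  by have := hs _ _ ll; lia.
have step j : \sum_(i < n) g k j i * ((c k j <= i < c k j.+1)%N%:R * \sum_(l < M) y l i)
    <= al * #|A j|%:R + (al + be).
  apply: (@le_trans _ _ (al * #|A j :|: B j|%:R + be)); last first.
    rewrite addrA lerD2r -[X in _ <= _ + X]mulr1 -mulrDr ler_wpM2l// ?natr1 ler_nat -addn1.
    by rewrite (leq_trans (leq_card_setU _ _))// leq_add2l.
  apply: le_trans (hA (A j :|: B j) _ n (Wg k j)); apply: ler_sum => i _.
  rewrite ler_wpM2l ?(norming_ge0 _ (Wg k j))// ger0_norm ?sumr_ge0// => [|l _]; last first.
    by have [] := hy l i.
  rewrite [in leLHS](bigID (mem (A j :|: B j)))/= mulrDr [X in _ + X]mulr_sumr.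
  rewrite [X in _ + X]big1 ?addr0; last first.
    move=> l; rewrite !inE negb_or => lAB.
    have [_ hyl] := hy l i.
    have [->|/hyl] := eqVneq (y l i) 0; first by rewrite mulr0.
    case: (boolP (c k j <= i < c k j.+1)%N) => [/andP[ci ic]|_ _]; last by rewrite mul0r.
    move=> /andP[si ti]; move: lAB.
    rewrite (leq_ltn_trans si ic) andbT (leq_ltn_trans ci ti) andbT.
    by case: leqP.
  rewrite ler_piMl ?lern1 ?leq_b1// sumr_ge0// => l _.
  by have [] := hy l i.
apply: (@le_trans _ _ (\sum_(j < pieces k) (al * #|A j|%:R + (al + be)))).
  by apply: ler_sum.
rewrite big_split/= sumr_const card_ord -mulr_sumr lerD//; last first.
  rewrite -[X in X <= _]mulr_natl ler_wpM2r ?addr_ge0// ?ler_nat.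
  by rewrite leq_pexp2l// leq_sqr ltnW.
rewrite ler_wpM2l//.
under eq_bigr => j _ do rewrite -sum1_card natr_sum big_mkcond/=.
rewrite exchange_big/= -[M in leRHS]card_ord -sumr_const.
apply: ler_sum => l _; apply: le_trans (sum_cut_le1 (pieces k) (sg l) (hc k)).
by apply: ler_sum => j _; rewrite inE; case: ifP.
Qed.

End layer_estimates.

(** * Windows of layers and the absence of flat block sequences *)

Section windows.
Context {R : realType}.
Implicit Types (f x : nat -> R) (y : nat -> nat -> R) (c : nat -> nat -> nat)
  (g : nat -> nat -> nat -> R).

Lemma layers_widen K p B c g i : admissible c g -> (p <= B)%N ->
  layers K p c g i <= layers K B c g i :> R.
Proof.
move=> [hc Wg] pB; have g0 k j : 0 <= g k j i by exact: norming_ge0.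
have [Kp|pK] := leqP K p; last by rewrite {1}/layers big_geq ?layers_ge0// ltnW.
rewrite /layers [leRHS](@big_cat_nat _ _ _ p)//= lerDl.
exact: (@layers_ge0 _ p B c g i).
Qed.

(** A functional norming [x1 + x2] with parameter [p >= B] would not see [x1], and
    [x2] alone is too small.  So [p < B]: it uses layers below [B] only, and after
    removal of what [x1] and the layers below [K] can bring, what is left is
    the action of the layers of the window on [x2]. *)
Lemma window x1 x2 r1 r2 tau lam K B :
  (forall i, 0 <= x1 i) -> (forall i, 0 <= x2 i) ->
  (forall i, x1 i != 0 -> (i < B)%N) ->
  normle x1 r1 -> normle x2 r2 -> r2 < tau ->
  (forall i, x1 i + x2 i <= tau) -> (K <= B)%N ->
  (forall c g n K', admissible c g -> (K' <= K)%N ->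
     \sum_(i < n) layers 0 K' c g i * x2 i <= lam) ->
  ~ normle (fun i => x1 i + x2 i) tau ->
  exists c g n, admissible c g /\
    tau - r1 - lam <= \sum_(i < n) layers K B c g i * x2 i.
Proof.
move=> x10 x20 x1B x1r x2r r2t xt KB low /not_normle[f [n [Wf]]].
have x0 i : 0 <= x1 i + x2 i by rewrite addr_ge0.
under eq_bigr => i _ do rewrite (ger0_norm (x0 i)).
have split f' : \sum_(i < n) f' i * (x1 i + x2 i) =
    \sum_(i < n) f' i * x1 i + \sum_(i < n) f' i * x2 i.
  by rewrite -big_split/=; apply: eq_bigr => i _; rewrite mulrDr.
case: Wf => {f} [i0|p c g hc Wg].
  rewrite ltNge => /negP[]; apply: le_trans (xt i0).
  under eq_bigr do rewrite mulrC -[X in X * _]mulr1 -[_ * 1 * _]mulrA mul1r.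
  have [i0n|ni0] := ltnP i0 n.
    rewrite (bigD1 (Ordinal i0n))//= eqxx mulr1 big1 ?addr0// => i ii0.
    by rewrite (negbTE (_ : (i : nat) != i0)) ?mulr0//.
  rewrite big1// => i _.
  have [e|_] := eqVneq (i : nat) i0; last by rewrite mulr0.
  by move: (ltn_ord i); rewrite e ltnNge ni0.
have acg : admissible c g by [].
have val2 : \sum_(i < n) (p <= i)%N%:R * layers 0 p c g i * x2 i <= r2.
  apply: le_trans (x2r _ n (norming_op p hc Wg)); apply: ler_sum => i _.
  by rewrite ger0_norm.
rewrite (split (fun i => (p <= i)%N%:R * layers 0 p c g i)) => tf.
have [Bp|pB] := leqP B p.
  exfalso; move: tf; rewrite big1 ?add0r; first by rewrite ltNge (le_trans val2)// ltW.
  move=> i _; have [->|/x1B iB] := eqVneq (x1 i) 0; first by rewrite mulr0.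
  by rewrite leqNgt (leq_trans iB Bp)/= !mul0r.
exists c, g, n; split=> //.
have val1 : \sum_(i < n) (p <= i)%N%:R * layers 0 p c g i * x1 i <= r1.
  apply: le_trans (x1r _ n (norming_op p hc Wg)); apply: ler_sum => i _.
  by rewrite ger0_norm.
have l0 a b i : 0 <= layers a b c g i by apply: layers_ge0 => k j; exact: norming_ge0.
have : \sum_(i < n) (p <= i)%N%:R * layers 0 p c g i * x2 i <=
    lam + \sum_(i < n) layers K B c g i * x2 i.
  apply: le_trans (lerD (low c g n (minn K p) acg (geq_minl _ _)) (lexx _)).
  rewrite -big_split/=; apply: ler_sum => i _; rewrite -mulrDl ler_wpM2r//.
  apply: (@le_trans _ _ (layers 0 p c g i)).
    by rewrite ler_piMl// lern1 leq_b1.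
  have [Kp|pK] := leqP K p.
    rewrite {1}/layers (@big_cat_nat _ _ _ K)//= lerD2l.
    exact: layers_widen (ltnW pB).
  by rewrite lerDl.
move: tf val1; move: (\sum_(i < n) _ * x1 i) (\sum_(i < n) _ * x2 i) => a b tf a1 b1.
lra.
Qed.

Lemma infinite_enum (P : nat -> Prop) : (forall N, exists l, (N <= l)%N /\ P l) ->
  forall N, exists e : nat -> nat,
    [/\ {homo e : i j / (i < j)%N}, (N <= e 0)%N & forall j, P (e j)].
Proof.
move=> /choice[s Ps] N; exists (fun j => iter j (fun i => s i.+1) (s N)); split.
- apply: homo_ltn; first exact: ltn_trans.
  by move=> i; rewrite iterS; have [] := Ps (iter i (fun i => s i.+1) (s N)).+1.
- by have [] := Ps N.
- by case=> [|j]; [have [] := Ps N|rewrite iterS; have [] := Ps (iter j (fun i => s i.+1) (s N)).+1].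
Qed.

Lemma blocks_sub sg y (k : nat -> nat) : blocks sg y ->
  {homo k : i j / (i < j)%N} -> blocks (sg \o k) (y \o k).
Proof.
move=> [hs hy] hk; split.
  by move=> i j ij; apply: hs; exact: (ltnW_homo hk).
move=> l i; have [y0 ys] := hy (k l) i; split=> //= /ys /andP[-> h]/=.
by rewrite (leq_trans h)// hs//; exact: hk.
Qed.

Lemma blocks_coord sg y M r i : blocks sg y -> 0 <= r ->
  (forall l, y l i <= r) -> \sum_(l < M) y l i <= r.
Proof.
move=> [hs hy] r0 yr.
have [[l0 yl0]|no] := pselect (exists l0 : 'I_M, y l0 i != 0); last first.
  rewrite big1// => l _; apply: contrapT => yl; apply: no; exists l.
  exact/eqP.
rewrite (bigD1 l0)//= big1 ?addr0// => l ll0; apply/eqP.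
apply: contraNT ll0 => yl.
have /andP[a1 a2] := (hy l0 i).2 yl0; have /andP[b1 b2] := (hy l i).2 yl.
apply/eqP/val_inj/eqP; rewrite /= eqn_leq; apply/andP; split; rewrite leqNgt; apply/negP => ll.
  by have := leq_trans a2 (leq_trans (hs _ _ ll) b1); rewrite ltnn.
by have := leq_trans b2 (leq_trans (hs _ _ ll) a1); rewrite ltnn.
Qed.

Lemma normle_sum (I : finType) (P : pred I) (z : I -> nat -> R) r :
  (forall l, normle (z l) r) -> normle (fun i => \sum_(l | P l) z l i) (r * #|P|%:R).
Proof.
move=> zr f n Wf.
apply: (@le_trans _ _ (\sum_(l | P l) \sum_(i < n) f i * `|z l i|)).
  rewrite exchange_big/=; apply: ler_sum => i _; rewrite -mulr_sumr.
  by rewrite ler_wpM2l ?norming_ge0// ler_norm_sum.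
rewrite mulr_natr -sumr_const; apply: ler_sum => l _; exact: zr.
Qed.

Lemma pieces_gt0 K : (0 < pieces K)%N. Proof. by rewrite expn_gt0. Qed.

Lemma leq_pieces K L : (K <= L)%N -> (pieces K <= pieces L)%N.
Proof. by move=> KL; rewrite leq_pexp2l// leq_sqr. Qed.

Section flat.
Variables (sg : nat -> nat) (y : nat -> nat -> R).
Hypotheses (yB : blocks sg y) (y1 : forall l, normle (y l) 1).
Hypothesis flat : forall m, (0 < m)%N -> exists T, forall k : nat -> nat,
  {homo k : i j / (i < j)%N} -> (T <= k 0)%N ->
  ~ normle (fun i => \sum_(l < m) y (k l) i) (3 / 4 * m%:R).

(** If infinitely many terms failed, the second half of a long sum could be chosen
    among them, far beyond the first half; [window] would then give layers in
    [[K, B[] with a large value on this second half, hence on one of its terms. *)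
Lemma flat_window K : exists B T, (K <= B)%N /\ forall l, (T <= l)%N ->
  exists c g n, admissible c g /\ 4^-1 <= \sum_(i < n) layers K B c g i * y l i.
Proof.
pose P := pieces K; have P0 : (0 < P)%N := pieces_gt0 K.
(* The sum has 8 P terms, where P is the number of intervals of layer K, so that
   the term counting these intervals in layers_upper is a small proportion. *)
have [|T HT] := flat (m := (4 * P + 4 * P)%N); first by rewrite addn_gt0 muln_gt0 P0.
pose h := (4 * P)%N; rewrite -/h in HT.
pose B := maxn K (sg (T + h)).
apply: contrapT => nwin.
have [|e [he eN ef]] := @infinite_enum (fun l => forall c g n, admissible c g ->
    \sum_(i < n) layers K B c g i * y l i < 4^-1) _ (T + h).
  move=> N; apply: contrapT => no; apply: nwin; exists B, N; split; first exact: leq_maxl.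
  move=> l Nl; apply: contrapT => nol; apply: no; exists l; split=> // c g n cg.
  by rewrite ltNge; apply/negP => v; apply: nol; exists c, g, n.
pose k l := if (l < h)%N then (T + l)%N else e (l - h)%N.
have hk : {homo k : i j / (i < j)%N}.
  move=> i j ij; rewrite /k; case: (ltnP j h) => jh; case: (ltnP i h) => ih; [lia|lia| |].
    have : (e 0 <= e (j - h))%N by apply: (ltnW_homo he).
    by lia.
  by apply: he; lia.
have Tk0 : (T <= k 0)%N by rewrite /k; case: ifP => _; [lia|rewrite sub0n; lia].
have yB' := blocks_sub yB hk; have yBe := blocks_sub yB he.
have y0 l i : 0 <= y l i by have [_ /(_ l i)[]] := yB.
pose x1 i := \sum_(l < h) y (T + l) i; pose x2 i := \sum_(l < h) y (e l) i.
have x12 i : \sum_(l < h + h) y (k l) i = x1 i + x2 i.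
  rewrite big_split_ord/=; congr (_ + _); apply: eq_bigr => l _; rewrite /k.
    by rewrite ltn_ord.
  by rewrite ltnNge leq_addr/= addKn.
have P1 : 1 <= P%:R :> R by rewrite ler1n.
have hP : h%:R = 4 * P%:R :> R by rewrite natrM.
have [||||||||||c [g [n [cg]]]] := @window x1 x2 h%:R h%:R (3 / 4 * (h + h)%:R) (8^-1 * (h%:R + P%:R)) K B.
- by move=> i; exact: sumr_ge0.
- by move=> i; exact: sumr_ge0.
- move=> i; apply: contraNT; rewrite -leqNgt => Bi.
  rewrite /x1 big1// => l _; apply/eqP; apply: contraTT (Bi) => yl.
  have [hs /(_ (T + l)%N i)[_ /(_ yl)/andP[_ h1]]] := yB.
  rewrite -ltnNge leq_max; apply/orP; right; apply: (leq_trans h1).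
  by rewrite hs// -addnS leq_add2l.
- by have := @normle_sum 'I_h xpredT (fun l => y (T + l)) 1 (fun l => y1 _);
    rewrite mul1r cardT size_enum_ord.
- by have := @normle_sum 'I_h xpredT (fun l => y (e l)) 1 (fun l => y1 _);
    rewrite mul1r cardT size_enum_ord.
- by rewrite natrD hP; lra.
- move=> i; rewrite -x12; apply: (@le_trans _ _ 1); last by rewrite natrD hP; lra.
  apply: (blocks_coord _ yB') => // l /=.
  by have := normle_coord i (y1 (k l)); rewrite ger0_norm.
- exact: leq_maxl.
- move=> c g n K' cg KK'.
  have HA (A : {set 'I_h}) : normle (fun i => \sum_(l in A) (y \o e) l i) (1 * #|A|%:R + 0).
    by rewrite addr0; exact: (@normle_sum _ (mem A) (fun l => y (e l)) 1 (fun l => y1 _)).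
  apply: (le_trans (@layers_upper R K' c g (sg \o e) (y \o e) h 1 0 n cg yBe ler01 (lexx _) HA)).
  by rewrite mul1r addr0 mulr1 ler_pM2l ?invr_gt0// lerD2l ler_nat leq_pieces.
- have := HT k hk Tk0; congr (~ normle _ _); apply/funext => i.
  by rewrite x12.
apply/negP; rewrite -ltNge.
under eq_bigr do rewrite mulr_sumr.
rewrite exchange_big/=.
apply: (@le_lt_trans _ _ (\sum_(l < h) 4^-1)).
  by apply: ler_sum => l _; exact/ltW/ef.
by rewrite sumr_const card_ord -(mulr_natr (4^-1)) natrD hP; lra.
Qed.

(** Functionals from disjoint windows add up, so a term lying far enough would have
    norm at least 5 / 4. *)
Lemma no_flat_blocks : (forall l, (l <= sg l)%N) -> False.
Proof.
move=> sgl.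
have y0 l i : 0 <= y l i by have [_ /(_ l i)[]] := yB.
have many s : exists B T, forall l, (T <= l)%N ->
    exists c g n, admissible c g /\ 4^-1 * s%:R <= \sum_(i < n) layers 0 B c g i * y l i.
  elim: s => [|s [B [T IH]]].
    exists 0%N, 0%N => l _; exists (fun _ _ => 0%N), (fun _ _ j => (j == 0%N)%:R), 0%N.
    by split; [exact: admissible0|rewrite mulr0 big_ord0].
  have [B' [T' [BB' IH']]] := flat_window B.
  exists B', (maxn T T') => l; rewrite geq_max => /andP[Tl Tl'].
  have [c [g [n [cg v]]]] := IH l Tl; have [c' [g' [n' [cg' v']]]] := IH' l Tl'.
  have [|c'' [g'' [cg'' e]]] := @layers_cat R 0 B B' c g c' g' cg cg'; first by rewrite leq0n.
  exists c'', g'', (maxn n n'); split=> //.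
  under eq_bigr do rewrite e mulrDl.
  rewrite big_split/= -[s.+1%:R]natr1 mulrDr mulr1 lerD//.
    apply: le_trans v _; apply: (@sum_nonneg_mono _ (fun i => layers 0 B c g i * y l i)); last exact: leq_maxl.
    by move=> i; rewrite mulr_ge0// layers_ge0// => k j; apply: norming_ge0; have [] := cg.
  apply: le_trans v' _; apply: (@sum_nonneg_mono _ (fun i => layers B B' c' g' i * y l i)); last exact: leq_maxr.
  by move=> i; rewrite mulr_ge0// layers_ge0// => k j; apply: norming_ge0; have [] := cg'.
have [B [T H]] := many 5%N.
have [c [g [n [cg v]]]] := H (maxn B T) (leq_maxr _ _).
have far i : y (maxn B T) i != 0 -> (B <= i)%N.
  have [_ /(_ (maxn B T) i)[_ h]] := yB => /h /andP[h1 _].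
  by rewrite (leq_trans _ h1)// (leq_trans _ (sgl _))// leq_maxl.
have := layers_far_le 0 n cg far (y1 _).
under eq_bigr do rewrite ger0_norm//.
by move=> /(le_trans v); lra.
Qed.
End flat.

End windows.

(** * The space *)

Section mixed_space.
Variable R : realType.
Implicit Types x : nat -> R^o.

Definition nrm x : R :=
  sup [set r | exists f n, norming f /\ r = \sum_(i < n) f i * `|x i|].

Lemma nrm_le x r : normle x r -> nrm x <= r.
Proof.
move=> xr; apply: ge_sup.
  by exists 0, (fun j => (j == 0%N)%:R), 0%N; split; [exact: norming_unit|rewrite big_ord0].
by move=> _ [f [n [Wf ->]]]; exact: xr.
Qed.

Lemma normle_nrm x r : normle x r -> normle x (nrm x).
Proof.
move=> xr f n Wf; apply: ub_le_sup; last by exists f, n.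
by exists r => _ [f' [n' [Wf' ->]]]; exact: xr.
Qed.

Definition is_mixed : {pred nat -> R^o} :=
  [pred u : nat -> R^o | `[< exists r, normle u r >]].

Lemma is_mixed_submod : submod_closed is_mixed.
Proof.
split.
  by apply/asboolP; exists 0 => f n _; rewrite big1// => i _; rewrite normr0 mulr0.
move=> a u v /asboolP[r ur] /asboolP[s vs]; apply/asboolP.
exists (`|a| * r + s).
exact: normleD (normleZ a ur) vs.
Qed.

HB.instance Definition _ :=
  GRing.isSubmodClosed.Build _ _ is_mixed is_mixed_submod.

Record mixed := Mixed { mixed_seq :> nat -> R^o ; _ : mixed_seq \in is_mixed }.

HB.instance Definition _ := [isSub for mixed_seq].
HB.instance Definition _ := [Choice of mixed by <:].
HB.instance Definition _ := [SubChoice_isSubLmodule of mixed by <:].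

Definition mixed_norm (u : mixed) : R := nrm u.

Lemma mixed_normle (u : mixed) : normle u (mixed_norm u).
Proof. by case: u => u /= h; have /asboolP[r ur] := h; exact: normle_nrm ur. Qed.

Lemma mixed_normD u v : mixed_norm (u + v) <= mixed_norm u + mixed_norm v.
Proof. by apply: nrm_le; apply: normleD; exact: mixed_normle. Qed.

Lemma mixed_normZ a u : mixed_norm (a *: u) = `|a| * mixed_norm u.
Proof.
have le b v : mixed_norm (b *: v) <= `|b| * mixed_norm v.
  by apply: nrm_le; apply: normleZ; exact: mixed_normle.
apply/eqP; rewrite eq_le le /=.
have [->|a0] := eqVneq a 0.
  by rewrite normr0 mul0r; exact: normle_ge0 (mixed_normle _).
rewrite mulrC -ler_pdivlMr ?normr_gt0// mulrC -normfV.
by rewrite -[in leLHS](scalerK a0 u) le.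
Qed.

Lemma mixed_norm_eq0 u : mixed_norm u = 0 -> u = 0.
Proof.
move=> u0; apply/val_inj/funext => n; apply/eqP; rewrite -normr_le0 -u0.
exact: normle_coord (mixed_normle u).
Qed.

HB.instance Definition _ := @Lmodule_isNormed.Build R mixed
  mixed_norm mixed_normD mixed_normZ mixed_norm_eq0.

Lemma mixedB (u v : mixed) i : (u - v) i = u i - v i. Proof. by []. Qed.
Lemma mixed_sum (I : Type) (s : seq I) (P : pred I) (F : I -> mixed) i :
  (\sum_(l <- s | P l) F l) i = \sum_(l <- s | P l) F l i.
Proof. by elim/big_rec2: _ => // l a b _ <-. Qed.

Lemma norm_mixed_normle (u : mixed) : normle u `|u|.
Proof. exact: mixed_normle. Qed.

Lemma norm_mixed_le (u : mixed) r : normle u r -> `|u| <= r.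
Proof. exact: nrm_le. Qed.

Lemma norm_mixed_coord (u : mixed) i : `|u i| <= `|u|.
Proof. exact: normle_coord (mixed_normle u). Qed.

Lemma normle_mixedP (u : mixed) r : normle u r <-> `|u| <= r.
Proof.
by split=> [|ur]; [exact: norm_mixed_le|exact: normle_le ur (mixed_normle u)].
Qed.

Lemma normle_is_mixed x r : normle x r -> x \in is_mixed.
Proof. by move=> xr; apply/asboolP; exists r. Qed.

Definition to_mixed x r (xr : normle x r) : mixed := Mixed (normle_is_mixed xr).

Lemma mixed_cauchy_cvg (F : set_system mixed) : ProperFilter F -> cauchy F -> cvg F.
Proof.
move=> FF /cauchyP cF.
have /choice[l Hl] (i : nat) : exists l : R, (fun v : mixed => v i : R^o) @ F --> l.
  suff : cauchy ((fun v : mixed => v i : R^o) @ F) by move=> /cauchy_cvg /cvg_ex[l ?]; exists l.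
  apply/cauchyP => e /cF[v Fv]; exists (v i : R^o).
  have h : F (fun w : mixed => ball (v i : R^o) e (w i)); last exact: h.
  apply: filterS Fv => w; rewrite -!ball_normE/= => vw.
  by apply: le_lt_trans vw; exact: (norm_mixed_coord (v - w) i).
have near (e : R) : 0 < e -> forall n, F [set v : mixed | forall i, (i < n)%N -> `|l i - v i| < e].
  move=> e0; elim=> [|n IH]; first by apply: filterS (filterT) => v _ i; rewrite ltn0.
  have /cvgrPdist_lt/(_ e e0) Hn := Hl n.
  apply: filterS (filterI IH Hn) => v [h1 h2] i; rewrite ltnS leq_eqVlt => /orP[/eqP->//|].
  exact: h1.
have dist e (u : mixed) : F (ball u e) -> normle (fun i => l i - u i) e.
  move=> Fu f n Wf; apply/ler_addgt0Pr => d d0.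
  have d'0 : 0 < d / n.+1%:R by rewrite divr_gt0.
  have [v [uv lv]] := @filter_ex _ _ FF _ (filterI Fu (near _ d'0 n)).
  apply: (@le_trans _ _ (\sum_(i < n) (f i * `|(v - u) i| + d / n.+1%:R))).
    apply: ler_sum => i _.
    have -> : l i - u i = (v - u) i + (l i - v i) by rewrite mixedB [RHS]addrC addrA subrK.
    apply: (@le_trans _ _ (f i * (`|(v - u) i| + `|l i - v i|))).
      by rewrite ler_wpM2l ?norming_ge0// ler_normD.
    rewrite mulrDr lerD2l; apply: (le_trans _ (ltW (lv i (ltn_ord i)))).
    by rewrite ler_piMl// norming_le1.
  rewrite big_split/= lerD//; last first.
    rewrite sumr_const card_ord -[leLHS]mulr_natr mulrAC ler_pdivrMr// ler_pM2l//.
    by rewrite ler_nat.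
  apply: le_trans (norm_mixed_normle (v - u) n Wf) _.
  by move: uv; rewrite -ball_normE/= distrC => /ltW.
have [u1 Fu1] := cF 1 ltr01.
have lr : normle l (1 + `|u1|).
  have := normleD (dist _ _ Fu1) (norm_mixed_normle u1).
  by apply: normle_dom => i /=; rewrite subrK.
apply/cvg_ex; exists (to_mixed lr); apply/cvgrPdist_le => e e0.
have e20 : 0 < e / 2 by rewrite divr_gt0.
have [u Fu] := cF (e / 2) e20.
have lu : `|to_mixed lr - u| <= e / 2 by apply: norm_mixed_le; exact: (dist _ _ Fu).
apply: (filterS _ Fu) => v uv.
rewrite -(subrK u (to_mixed lr)) -addrA (le_trans (ler_normD _ _))//.
rewrite [leRHS](splitr e) lerD//.
by move: uv; rewrite -ball_normE/= => /ltW.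
Qed.

HB.instance Definition _ := Uniform_isComplete.Build mixed mixed_cauchy_cvg.

End mixed_space.

(** * The unit vector basis *)

Section mixed_basis.
Variable R : realType.
Implicit Types (u : mixed R).

Lemma weight_pieces_unbounded (A : R) : exists K, A < weight K * (pieces K)%:R.
Proof.
pose K := (Num.bound `|A| + 4)%N; exists K.
have e1 : (K + 4 + K <= K ^ 2)%N by rewrite /K; nia.
apply: (@lt_le_trans _ _ (2 ^+ K)).
  apply: (@lt_trans _ _ (Num.bound `|A|)%:R); first exact: (le_lt_trans (ler_norm _) (archi_boundP (normr_ge0 A))).
  rewrite -natrX ltr_nat; apply: (leq_ltn_trans (leq_addr 4 _)); exact: ltn_expl.
rewrite /weight /pieces natrX exprVn mulrC ler_pdivlMr ?exprn_gt0// -exprD.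
by rewrite ler_weXn2l ?ler1n// addnC.
Qed.

Definition restr (A : pred nat) (x : nat -> R) (i : nat) : R := (A i)%:R * x i.

Lemma restr_le A (x : nat -> R) i : `|restr A x i| <= `|x i|.
Proof. by rewrite normrM normr_nat ler_piMl// lern1 leq_b1. Qed.

Lemma normle_restr (A : pred nat) (x : nat -> R) r : normle x r -> normle (restr A x) r.
Proof. by apply: normle_dom => i; exact: restr_le. Qed.

Definition mixed_restr (A : pred nat) u : mixed R :=
  to_mixed (normle_restr A (norm_mixed_normle u)).

Lemma mixed_restrE A u i : mixed_restr A u i = (A i)%:R * u i. Proof. by []. Qed.

Lemma norm_mixed_restr A u : `|mixed_restr A u| <= `|u|.
Proof. by apply: norm_mixed_le; exact/normle_restr/norm_mixed_normle. Qed.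

Lemma norm_mixed_dom (u v : mixed R) : (forall i, `|u i| <= `|v i|) -> `|u| <= `|v|.
Proof. by move=> uv; apply/norm_mixed_le/(normle_dom uv)/norm_mixed_normle. Qed.

(** If the tails stayed above [e], each layer could be filled with consecutive
    pieces of norm above [e], and the number of pieces beats the weight.  This makes
    the unit vectors a boundedly complete basis. *)
Lemma mixed_tail u (e : R) : 0 < e -> exists n, `|mixed_restr (leq n) u| <= e.
Proof.
move=> e0; apply: contrapT => no.
have /choice[M HM] (n : nat) : exists m, (n <= m)%N /\
    ~ normle (fun i => (n <= i < m)%N%:R * u i) e.
  have : ~ normle (mixed_restr (leq n) u) e.
    by move=> h; apply: no; exists n; exact: norm_mixed_le.
  move=> /not_normle[f [n0 [Wf ef]]]; exists (maxn n n0); split; first exact: leq_maxl.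
  move=> /(_ _ n0 Wf); rewrite leNgt => /negP[]; apply: lt_le_trans ef _.
  apply: ler_sum => i _; rewrite ler_wpM2l ?norming_ge0// mixed_restrE !normrM ler_wpM2r//.
  by rewrite !normr_nat (leq_trans (ltn_ord i) (leq_maxr _ _)) andbT.
have [K HK] := weight_pieces_unbounded (`|u| / e).
pose c j := iter j M K.+1.
have hc : {homo c : i j / (i <= j)%N}.
  by apply: homo_leq => [//||j]; [exact: leq_trans|rewrite /c iterS; have [] := HM (iter j M K.+1)].
have := layer_lower hc (ltnSn K) (fun j _ => (HM (c j)).2) (norm_mixed_normle u).
by rewrite leNgt -ltr_pdivrMr ?HK.
Qed.

Definition bvec (n : nat) : nat -> R := fun i => (i == n)%:R.

Lemma normle_bvec n : normle (bvec n) 1.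
Proof.
move=> f m Wf; have [nm|mn] := ltnP n m; last first.
  rewrite big1// => i _; rewrite /bvec.
  by rewrite (ltn_eqF (leq_trans (ltn_ord i) mn)) normr0 mulr0.
rewrite (bigD1 (Ordinal nm))//= big1 ?addr0 => [|i ni].
  by rewrite /bvec eqxx normr1 mulr1 norming_le1.
by rewrite /bvec (negbTE (_ : (i : nat) != n)) ?normr0 ?mulr0.
Qed.

Definition mbasis (n : nat) : mixed R := to_mixed (normle_bvec n).

Lemma mbasisE n i : mbasis n i = (i == n)%:R :> R. Proof. by []. Qed.

Lemma mbasis_series (a : nat -> R) n i :
  series (fun k => a k *: mbasis k) n i = (i < n)%N%:R * a i.
Proof.
rewrite /series/= mixed_sum big_mkord.
have [im|mi] := ltnP i n; last first.
  rewrite mul0r big1// => k _; rewrite [LHS](_ : _ = a k * (i == k)%:R :> R)//.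
  by rewrite gtn_eqF ?mulr0// (leq_trans (ltn_ord k) mi).
rewrite mul1r (bigD1 (Ordinal im))//= big1 ?addr0 => [|k ki].
  by rewrite [LHS](_ : _ = a i * (i == i)%:R :> R)// eqxx mulr1.
rewrite [LHS](_ : _ = a k * (i == k)%:R :> R)// (negbTE (_ : i != k)) ?mulr0//.
by apply: contraNN ki => /eqP ik; apply/eqP/val_inj.
Qed.

Lemma mbasis_cvg_coord (a : nat -> R) u :
  series (fun n => a n *: mbasis n) @ \oo --> u -> forall i, a i = u i.
Proof.
move=> /cvgrPdist_le su i.
apply/eqP; rewrite eq_sym -subr_eq0 -normr_le0; apply/ler_addgt0Pl => e e0.
rewrite addr0; have [n [i_n nu]] := @filter_ex _ (nbhs \oo) _ _ (@filterI _ (nbhs \oo) _ _ _ (nbhs_infty_gt i) (su e e0)).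
apply: le_trans nu; apply: le_trans (norm_mixed_coord _ i).
by rewrite mixedB mbasis_series i_n mul1r.
Qed.

(** Stated for all rearrangements at once: the remainder of a rearranged partial sum
    is dominated coordinatewise by a tail. *)
Lemma mbasis_expansion u (s : nat -> nat) : bijective s ->
  series ((fun n => u n *: mbasis n) \o s) @ \oo --> u.
Proof.
move=> [t st ts]; apply/cvgrPdist_le => e e0.
have [N HN] := mixed_tail u e0.
pose n0 := (\max_(i < N) (t i).+1)%N.
near=> n; apply: le_trans HN; apply: norm_mixed_dom => i.
have is_ : series ((fun n => u n *: mbasis n) \o s) n i = (t i < n)%N%:R * u i.
  rewrite /series/= mixed_sum big_mkord.
  have [im|mi] := ltnP (t i) n; last first.
    rewrite mul0r big1// => k _; rewrite [LHS](_ : _ = u (s k) * (i == s k)%:R :> R)//.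
    case: eqVneq => [ik|]; last by rewrite mulr0.
    by move: (ltn_ord k); rewrite -[k : nat]st -ik ltnNge mi.
  rewrite mul1r (bigD1 (Ordinal im))//= big1 ?addr0 => [|k ki].
    by rewrite [LHS](_ : _ = u (s (t i)) * (i == s (t i))%:R :> R)// ts eqxx mulr1.
  rewrite [LHS](_ : _ = u (s k) * (i == s k)%:R :> R)// (negbTE (_ : i != s k)) ?mulr0//.
  by apply: contraNN ki => /eqP ik; apply/eqP/val_inj; rewrite /= ik st.
rewrite mixedB is_ mixed_restrE.
have [Ni|iN] := leqP N i.
  rewrite mul1r; case: (t i < n)%N; last by rewrite mul0r subr0.
  by rewrite mul1r subrr normr0.
suff -> : (t i < n)%N by rewrite mul1r subrr normr0 normr_ge0.
apply: (@leq_trans n0); first by exact: (leq_bigmax (Ordinal iN)).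
by near: n; exact: nbhs_infty_ge.
Unshelve. all: by end_near. Qed.

Lemma mbasis_unconditional : unconditional_basis mbasis.
Proof.
split.
  split=> // u _; exists u; split.
    by have := @mbasis_expansion u id; apply; exists id.
  by move=> a /mbasis_cvg_coord h; apply/funext => i; rewrite h.
move=> a /cvg_ex[u su] s bs; apply/cvg_ex; exists u.
have -> : a = u by apply/funext => i; rewrite (mbasis_cvg_coord su).
exact: mbasis_expansion.
Qed.

(** Otherwise [n + 1] unit vectors would be combinations of [n] vectors, and the
    identity matrix would factor through dimension [n]. *)
Lemma mixed_infinite_dimensional : infinite_dimensional (mixed R).
Proof.
move=> n v; apply: contrapT => no.
have /choice[A HA] (j : 'I_n.+1) : exists a : 'I_n -> R, mbasis j = \sum_(i < n) a i *: v i.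
  apply: contrapT => nj; apply: no; exists (mbasis j) => a e; apply: nj; by exists a.
have : (\matrix_(j, i) A j i : 'M[R]_(n.+1, n)) *m (\matrix_(i, l) (v i l : R) : 'M[R]_(n, n.+1)) = 1%:M.
  apply/matrixP => j l; rewrite !mxE.
  transitivity (mbasis j l : R); last by rewrite mbasisE eq_sym.
  by rewrite HA mixed_sum; apply: eq_bigr => i _; rewrite !mxE.
by move=> /mulmx1_min; rewrite ltnn.
Qed.

End mixed_basis.

(** * Duality and reflexivity *)

Section dual_facts.
Context {R : realType} {X : normedModType R}.
Implicit Types (f : dual X) (x : X).

Lemma dualD f x z : f (x + z) = f x + f z.
Proof. by have := dual_linear f 1 x z; rewrite !scale1r. Qed.

Lemma dual0 f : f 0 = 0.
Proof. by have := dual_linear f (-1) 0 0; rewrite scaler0 addr0 scaleN1r addNr. Qed.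

Lemma dualZ f (a : R) x : f (a *: x) = a * f x.
Proof. by have := dual_linear f a x 0; rewrite addr0 dual0 addr0. Qed.

Lemma dualN f x : f (- x) = - f x.
Proof. by rewrite -scaleN1r dualZ mulN1r. Qed.

Lemma dualB f x z : f (x - z) = f x - f z.
Proof. by rewrite dualD dualN. Qed.

Lemma dual_sum f (I : Type) (s : seq I) (P : pred I) (F : I -> X) :
  f (\sum_(i <- s | P i) F i) = \sum_(i <- s | P i) f (F i).
Proof.
elim/big_rec2: _ => [|i a b _ <-]; first exact: dual0.
exact: dualD.
Qed.

Lemma dual_sum_val (I : Type) (s : seq I) (P : pred I) (F : I -> dual X) x :
  (\sum_(i <- s | P i) F i) x = \sum_(i <- s | P i) F i x.
Proof. by elim/big_rec2: _ => // i a b _ <-. Qed.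

Lemma dual_norm_le f r : (forall x, `|x| <= 1 -> `|f x| <= r) -> `|f| <= r.
Proof. by move=> fr; apply: sup_norm_le => //; exists 0; rewrite /= normr0. Qed.

Lemma dual_le f x : `|f x| <= `|f| * `|x|.
Proof.
have [->|x0] := eqVneq x 0; first by rewrite dual0 !normr0 mulr0.
have : `|f (`|x|^-1 *: x)| <= `|f|.
  by apply: (le_sup_norm (dual_bounded f)); rewrite /= normfZV.
by rewrite dualZ normrM normfV normr_id mulrC ler_pdivrMr ?normr_gt0.
Qed.

Lemma bounded_functional (h : X -> R^o) (M : R) : linear h ->
  (forall x, `|h x| <= M * `|x|) -> h \in @is_functional R X.
Proof.
move=> lh hM; apply/asboolP; split=> //.
pose hL := HB.pack_for {linear X -> R^o} h (GRing.isLinear.Build R X R^o _ h lh).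
suff : continuous hL by [].
apply/linear_bounded_continuous/bounded_funP => r; exists (`|M| * r) => x xr.
apply: (le_trans (hM x)); apply: (@le_trans _ _ (`|M| * `|x|)).
  by rewrite ler_wpM2r// ler_norm.
by rewrite ler_wpM2l.
Qed.

Definition mk_dual (h : X -> R^o) (M : R) (lh : linear h)
  (hM : forall x, `|h x| <= M * `|x|) : dual X := Dual (bounded_functional lh hM).

End dual_facts.

Section mixed_reflexive.
Variable R : realType.
Implicit Types (u : mixed R) (f : dual (mixed R)).

(** Otherwise let [eta] be the infimum of the norms of the restrictions of [f] to tails.
    Beyond the place where this norm is below 11/10 [eta], blocks in the unit ball on
    which [f] exceeds 9/10 [eta] exist arbitrarily far, and the norm of a sum of m
    of them is at least m * 9/11, against [no_flat_blocks]. *)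
Lemma mixed_shrinking f (e : R) : 0 < e ->
  exists n, forall u, (forall i, (i < n)%N -> u i = 0) -> `|f u| <= e * `|u|.
Proof.
move=> e0; apply: contrapT => no.
pose A := [set r : R | exists n, forall u, (forall i, (i < n)%N -> u i = 0) -> `|f u| <= r * `|u|].
have Ae r : A r -> e <= r.
  move=> [n Hn]; rewrite leNgt; apply/negP => re; apply: no; exists n => u un.
  by apply: (le_trans (Hn u un)); rewrite ler_wpM2r// ltW.
have A0 : A !=set0 by exists `|f|, 0%N => u _; exact: dual_le.
have iA : has_inf A by split=> //; exists e => r /Ae.
pose eta := inf A.
have eta_e : e <= eta by apply: lb_le_inf => // r /Ae.
have eta0 : 0 < eta by exact: lt_le_trans eta_e.
have [r0 [n0 Hn0] r0eta] : exists2 r, A r & r < eta + eta / 10.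
  by apply: inf_adherent => //; rewrite divr_gt0.
have r00 : 0 < r0 by apply: (lt_le_trans e0); apply: Ae; exists n0.
have big n : exists (u : mixed R) m, [/\ (n < m)%N, forall i, u i != 0 -> (n <= i < m)%N, `|u| <= 1 & eta * (9 / 10) < f u].
  have : ~ A (eta * (19 / 20)).
    move=> /ge_inf; rewrite -/eta => h; have := h iA.2; lra.
  move=> nA; have [u un fu] : exists2 u : mixed R, (forall i, (i < n)%N -> u i = 0) & eta * (19 / 20) * `|u| < `|f u|.
    apply: contrapT => nu; apply: nA; exists n => u un; rewrite leNgt; apply/negP => fu.
    by apply: nu; exists u.
  have u0 : 0 < `|u|.
    rewrite normr_gt0; apply/eqP => u0; move: fu.
    by rewrite u0 dual0 !normr0 mulr0 ltxx.
  pose v := (Num.sg (f u) / `|u|) *: u.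
  have v1 : `|v| <= 1.
    rewrite /v normrZ normrM normfV normr_id -mulrA mulVf ?gt_eqF// mulr1 normr_sg.
    by case: (_ != 0).
  have fv : eta * (19 / 20) < f v.
    by rewrite /v dualZ -mulrA [ltRHS]mulrCA -normrEsg [ltRHS]mulrC ltr_pdivlMr.
  have d0 : 0 < eta / 20 / (`|f| + 1) by rewrite !divr_gt0// ltr_wpDl.
  have [m Hm] := mixed_tail v d0.
  pose w := mixed_restr (fun i : nat => (i < maxn m n.+1)%N) v.
  exists w, (maxn m n.+1); split.
  - exact: leq_maxr.
  - move=> i; rewrite mixed_restrE; have [ni|ni] := leqP n i.
      by case: (i < _)%N => //; rewrite mul0r eqxx.
    by rewrite [v i](_ : _ = Num.sg (f u) / `|u| * u i :> R)// un// !mulr0 eqxx.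
  - exact: le_trans (norm_mixed_restr _ _) v1.
  - have vw : `|v - w| <= eta / 20 / (`|f| + 1).
      apply: le_trans Hm; apply: norm_mixed_dom => i; rewrite mixedB !mixed_restrE.
      case: (ltnP i (maxn m n.+1)) => im; first by rewrite mul1r subrr normr0.
      by rewrite mul0r subr0 (leq_trans (leq_maxl _ _) im) mul1r.
    have : `|f (v - w)| <= eta / 20.
      apply: (le_trans (dual_le _ _)).
      apply: (@le_trans _ _ ((`|f| + 1) * (eta / 20 / (`|f| + 1)))).
        by rewrite ler_pM// lerDl.
      by rewrite mulrC divfK// gt_eqF// ltr_wpDl.
    rewrite dualB => /ler_normlP[_]; move: fv; move: (f v) (f w) => a b; lra.
have /choice[U /choice[M HU]] := big.
pose sg l := iter l M n0.
have sgS l : (sg l < sg l.+1)%N by rewrite /sg iterS; have [] := HU (iter l M n0).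
have hs : {homo sg : i j / (i <= j)%N}.
  by apply: homo_leq => [//||l]; [exact: leq_trans|exact: ltnW].
have sgl l : (l <= sg l)%N by elim: l => // l IH; exact: leq_ltn_trans (sgS l).
pose y l i : R := `|U (sg l) i|.
have yB : blocks sg y.
  split=> // l i; split; first exact: normr_ge0.
  by rewrite /y normr_eq0; have [_ h _ _] := HU (sg l); exact: h.
apply: (no_flat_blocks yB _ _ sgl).
  move=> l; have [_ _ h _] := HU (sg l); move/normle_mixedP : h.
  by apply: normle_dom => i; rewrite /y normr_id.
move=> m m0; exists 0%N => k hk _ h.
pose Z := \sum_(l < m) U (sg (k l)).
have Zle : `|Z| <= 3 / 4 * m%:R.
  apply: norm_mixed_le; apply: normle_dom h => i.
  rewrite /Z mixed_sum [leRHS]ger0_norm; last by apply: sumr_ge0 => l _; exact: normr_ge0.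
  exact: (le_trans (ler_norm_sum _ _ _) (lexx _)).
have Zn0 i : (i < n0)%N -> Z i = 0.
  move=> i0; rewrite /Z mixed_sum big1// => l _; apply/eqP.
  apply: contraTT (i0); rewrite -leqNgt.
  have [_ h1 _ _] := HU (sg (k l)); move=> /h1 /andP[h2 _].
  by apply: leq_trans h2; exact: (hs 0%N).
have fZ : eta * (9 / 10) * m%:R <= f Z.
  rewrite dual_sum mulr_natr -[in leLHS](card_ord m) -sumr_const; apply: ler_sum => l _.
  by have [_ _ _ /ltW] := HU (sg (k l)).
have := le_trans fZ (le_trans (ler_norm _) (Hn0 Z Zn0)).
have m1 : 1 <= m%:R :> R by rewrite ler1n.
move=> h1; have : r0 * `|Z| <= r0 * (3 / 4 * m%:R) by rewrite ler_wpM2l// ltW.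
have : r0 * m%:R <= (eta + eta / 10) * m%:R by rewrite ler_wpM2r// ltW.
have : 0 < eta * m%:R by rewrite mulr_gt0// ltr0n.
move: h1; move: (r0 * _) => a; nra.
Qed.

Definition coordinate (i : nat) : dual (mixed R).
Proof.
apply: (@mk_dual R (mixed R) (fun u => u i) 1); first by [].
by move=> u; rewrite mul1r; exact: norm_mixed_coord.
Defined.

(** The values of an element of the bidual on the coordinate functionals define an
    element of the space, since finite norming functionals are combinations of
    coordinates; the shrinking property extends the equality to all functionals. *)
Theorem mixed_reflexive : reflexive_space (mixed R).
Proof.
move=> Phi.
pose x i : R := Phi (coordinate i).
have xle : normle x `|Phi|.
  move=> f n Wf.
  pose F : dual (mixed R) := \sum_(i < n) (f i * Num.sg (x i)) *: coordinate i.
  have FE u : F u = \sum_(i < n) f i * Num.sg (x i) * u i.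
    by rewrite /F dual_sum_val.
  have F1 : `|F| <= 1.
    apply: dual_norm_le => u u1; rewrite FE.
    apply: le_trans (le_trans (norm_mixed_normle u n Wf) u1).
    apply: (le_trans (ler_norm_sum _ _ _)); apply: ler_sum => i _.
    rewrite !normrM (ger0_norm (norming_ge0 _ Wf)) -mulrA ler_wpM2l ?(norming_ge0 _ Wf)//.
    by rewrite ler_piMl// normr_sg; case: (_ != 0).
  have -> : \sum_(i < n) f i * `|x i| = Phi F.
    rewrite /F dual_sum; apply: eq_bigr => i _.
    by rewrite dualZ -mulrA -normrEsg.
  apply: (le_trans (ler_norm _)); apply: (le_trans (dual_le _ _)).
  by rewrite ler_piMr.
exists (to_mixed xle) => f; set X := to_mixed xle.
apply/eqP; rewrite -subr_eq0 -normr_le0; apply/ler_addgt0Pl => e e0; rewrite addr0.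
have C0 : 0 < `|Phi| + `|X| + 1 by rewrite ltr_wpDl// addr_ge0.
have [n Hn] := mixed_shrinking f (divr_gt0 e0 C0).
set d := e / _ in Hn; have d0 : 0 < d by rewrite divr_gt0.
pose fn : dual (mixed R) := \sum_(i < n) f (mbasis R i) *: coordinate i.
have fnE u : fn u = \sum_(i < n) f (mbasis R i) * u i by rewrite /fn dual_sum_val.
have split u : f u - fn u = f (mixed_restr (leq n) u).
  have -> : fn u = f (\sum_(i < n) u i *: mbasis R i).
    by rewrite fnE dual_sum; apply: eq_bigr => i _; rewrite dualZ mulrC.
  rewrite -dualB; congr (f _); apply/val_inj/funext => i.
  have := mbasis_series u n i; rewrite /series/= big_mkord => h.
  transitivity ((u i - (i < n)%N%:R * u i) : R); first by congr (_ - _).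
  rewrite [RHS](_ : _ = (n <= i)%N%:R * u i :> R)//.
  by case: leqP => _; rewrite ?mul0r ?mul1r ?subr0 ?subrr.
have tail u : `|f u - fn u| <= d * `|u|.
  rewrite split; apply: le_trans (Hn _ _) _; last by rewrite ler_wpM2l ?norm_mixed_restr// ltW.
  by move=> i iN; rewrite mixed_restrE leqNgt iN mul0r.
have h1 : `|Phi f - Phi fn| <= `|Phi| * d.
  rewrite -dualB; apply: le_trans (dual_le _ _) _; rewrite ler_wpM2l//.
  apply: dual_norm_le => u u1; apply: le_trans (tail u) _.
  by rewrite ler_piMr// ltW.
have h2 : Phi fn = fn X.
  by rewrite fnE /fn dual_sum; apply: eq_bigr => i _; rewrite dualZ.
have h3 := tail X.
have -> : Phi f - f X = (Phi f - Phi fn) - (f X - fn X) by rewrite h2 opprB addrA subrK.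
apply: (le_trans (ler_normB _ _)); apply: (le_trans (lerD h1 h3)).
have dC : d * (`|Phi| + `|X| + 1) = e by rewrite divfK// lt0r_neq0.
rewrite [`|Phi| * d]mulrC -mulrDr -[leRHS]dC.
rewrite ler_wpM2l ?(ltW d0)//.
by rewrite lerDl.
Qed.

End mixed_reflexive.

(** * Sandwich theorem for the norm *)

Section sandwich.
Context {R : realType} {X : normedModType R}.
Implicit Types (p q : X -> R) (x : X).

Definition sublinear q :=
  (forall x z, q (x + z) <= q x + q z) /\
  forall (t : R) x, 0 < t -> q (t *: x) <= t * q x.

Lemma sublinear0 q : sublinear q -> q 0 = 0.
Proof.
move=> [_ qZ]; apply/eqP; rewrite eq_le.
have := qZ 2 0 ltac:(by []); have := qZ 2^-1 0 ltac:(by rewrite invr_gt0).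
by rewrite !scaler0 => h1 h2; apply/andP; split; lra.
Qed.

Lemma sublinearZ q (t : R) x : sublinear q -> 0 < t -> q (t *: x) = t * q x.
Proof.
move=> sq t0; apply/eqP; rewrite eq_le sq.2//=.
have := sq.2 t^-1 (t *: x); rewrite invr_gt0 t0 scalerK ?gt_eqF// => /(_ isT).
by rewrite mulrC ler_pdivlMr// mulrC.
Qed.

Lemma sublinear_ge q x : sublinear q -> - q (- x) <= q x.
Proof. by move=> sq; have := sq.1 x (- x); rewrite subrr sublinear0//; lra. Qed.

(** The three infima needed below (the minimality argument, chains in the
    lemma of Zorn, and the starting functional of [sandwich]) are instances. *)
Lemma inf_sublinear (I : Type) (S : set I) (F : I -> X -> R) (lb : X -> R) :
  S !=set0 -> (forall i x, S i -> lb x <= F i x) ->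
  (forall i j x z, S i -> S j -> exists2 k, S k & F k (x + z) <= F i x + F j z) ->
  (forall i (t : R) x, S i -> 0 < t -> exists2 k, S k & F k (t *: x) <= t * F i x) ->
  exists q, [/\ sublinear q, forall i x, S i -> q x <= F i x &
    forall (b : R) x, (forall i, S i -> b <= F i x) -> b <= q x].
Proof.
move=> [i0 Si0] hlb hD hZ; pose A x := [set F i x | i in S].
have iA x : has_inf (A x).
  by split; [exists (F i0 x), i0|exists (lb x) => _ [i Si <-]; exact: hlb].
exists (fun x => inf (A x)).
have le i x : S i -> inf (A x) <= F i x.
  by move=> Si; apply: ge_inf; [exact: (iA x).2|exists i].
have ge (b : R) x : (forall i, S i -> b <= F i x) -> b <= inf (A x).
  by move=> h; apply: lb_le_inf; [exact: (iA x).1|move=> _ [i Si <-]; exact: h].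
split=> //; split.
  move=> x z /=; rewrite -lerBlDr; apply: (ge _ _) => i Si; rewrite lerBlDr [leRHS]addrC -lerBlDr.
  apply: (ge _ _) => j Sj; rewrite lerBlDr.
  by have [k Sk h] := hD i j x z Si Sj; apply: (le_trans (le k _ Sk)); rewrite [leRHS]addrC.
move=> t x t0 /=; rewrite mulrC -ler_pdivrMr//; apply: (ge _ _) => i Si; rewrite ler_pdivrMr//.
by have [k Sk h] := hZ i t x Si t0; apply: (le_trans (le k _ Sk)); rewrite mulrC.
Qed.

(** For each [a], the infimum over [t >= 0] of [q (x + t a) - t q a] is sublinear
    and below [q], so it equals [q]; at [- a] this gives [q (- a) <= - q a]. *)
Lemma minimal_sublinear_linear q : sublinear q ->
  (forall q', sublinear q' -> (forall x, q' x <= q x) -> q' = q) -> linear (q : X -> R^o).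
Proof.
move=> sq mq.
have odd a : q (- a) = - q a.
  apply/eqP; rewrite eq_le; apply/andP; split; last by rewrite lerNl; have := sublinear_ge (- a) sq; rewrite opprK; lra.
  have qt (t : R) : 0 <= t -> q (t *: a) = t * q a.
    rewrite le_eqVlt => /orP[/eqP<-|]; first by rewrite scale0r mul0r sublinear0.
    exact: sublinearZ.
  have [||||q' [sq' q'le _]] := @inf_sublinear R [set t : R | 0 <= t]
      (fun t x => q (x + t *: a) - t * q a) (fun x => - q (- x)).
  - by exists 0; rewrite /=.
  - move=> t x t0 /=; have := sq.1 (- x) (x + t *: a).
    by rewrite addrA addNr add0r qt//; lra.
  - move=> t s x z t0 s0; exists (t + s); first exact: addr_ge0.
    have := sq.1 (x + t *: a) (z + s *: a).
    rewrite addrACA -scalerDl mulrDl; lra.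
  - move=> t s x t0 s0; exists (s * t); first by rewrite /= mulr_ge0// ltW.
    by rewrite -scalerA -scalerDr mulrBr mulrA lerD2r; exact: sq.2.
  have q'q : q' = q.
    apply: mq => // x; have := q'le 0 x (lexx _).
    by rewrite scale0r addr0 mul0r subr0.
  have := q'le 1 (- a) ler01; rewrite q'q scale1r addNr mul1r sublinear0//.
  by rewrite sub0r.
have add x z : q (x + z) = q x + q z.
  apply/eqP; rewrite eq_le sq.1/=.
  by have := sq.1 (x + z) (- z); rewrite addrK odd; lra.
move=> t x z; rewrite add; congr (_ + _).
have [t0|t0|<-] := ltgtP 0 t; first exact: sublinearZ.
  have := sublinearZ x sq (_ : 0 < - t); rewrite oppr_gt0 t0 => /(_ isT).
  by rewrite scaleNr odd => /eqP; rewrite mulNr eqr_opp => /eqP.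
by rewrite !scale0r sublinear0.
Qed.

Lemma sublinear_dominates p : sublinear p ->
  exists h : X -> R^o, linear h /\ forall x, h x <= p x.
Proof.
move=> sp.
pose T := {q | sublinear q /\ forall x, q x <= p x}.
pose below (q1 q2 : T) := `[< forall x, sval q2 x <= sval q1 x >].
have [||||q mq] := @Zorn T below.
- by move=> q; apply/asboolP.
- by move=> r s t /asboolP rs /asboolP st; apply/asboolP => x; exact: le_trans (rs x).
- move=> [s Ps] [t Pt] /asboolP st /asboolP ts; apply: eq_exist => /=.
  by apply/funext => x; apply/eqP; rewrite eq_le ts st.
- move=> A totA; have [[q0 Aq0]|A0] := pselect (A !=set0); last first.
    by exists (exist _ p (conj sp (fun x => lexx _))) => s As; exfalso; apply: A0; exists s.
  have [||||q [sq qle _]] := @inf_sublinear T A (fun s x => sval s x) (fun x => - p (- x)).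
  + by exists q0.
  + move=> s x _; have := sublinear_ge x (svalP s).1.
    by apply: le_trans; rewrite lerN2; exact: (svalP s).2.
  + move=> s t x z As At; have [/asboolP h|/asboolP h] := totA s t As At.
      exists t => //; apply: le_trans ((svalP t).1.1 x z) _; by rewrite lerD2r.
    by exists s => //; apply: le_trans ((svalP s).1.1 x z) _; rewrite lerD2l.
  + by move=> s t x As t0; exists s => //; exact: (svalP s).1.2.
  have qp x : q x <= p x by apply: le_trans (qle q0 x Aq0) _; exact: (svalP q0).2.
  by exists (exist _ q (conj sq qp)) => s As; apply/asboolP => x; exact: qle.
exists (sval q); split; last exact: (svalP q).2.
apply: minimal_sublinear_linear; first exact: (svalP q).1.
move=> q' sq' q'q.
have q'p x : q' x <= p x by apply: le_trans (q'q x) _; exact: (svalP q).2.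
have := mq (exist _ q' (conj sq' q'p)) ltac:(by apply/asboolP).
by move=> <-.
Qed.

(** A Mazur-Orlicz form of the Hahn-Banach theorem: the values of a functional of
    norm at most 1 can be prescribed from below on a cone as soon as the prescription
    is compatible with the norm.  The starting sublinear functional is the infimum
    of [|x + w| - r] over the pairs [(w, r)] of the cone. *)
Theorem sandwich (C : set (X * R)) :
  C (0, 0) -> (forall c d, C c -> C d -> C (c.1 + d.1, c.2 + d.2)) ->
  (forall (t : R) c, 0 < t -> C c -> C (t *: c.1, t * c.2)) ->
  (forall c, C c -> c.2 <= `|c.1|) ->
  exists f : dual X, `|f| <= 1 /\ forall c, C c -> c.2 <= f c.1.
Proof.
move=> C0 CD CZ Cle.
have [||||p [sp ple _]] := @inf_sublinear (X * R)%type C (fun c x => `|x + c.1| - c.2) (fun x => - `|x|).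
- by exists (0, 0).
- move=> c x Cc; have := Cle _ Cc; have := ler_normB (x + c.1) x.
  by rewrite addrAC subrr add0r; lra.
- move=> c d x z Cc Cd; exists (c.1 + d.1, c.2 + d.2); first exact: CD.
  by have := ler_normD (x + c.1) (z + d.1); rewrite addrACA /=; lra.
- move=> c t x Cc t0; exists (t *: c.1, t * c.2); first exact: CZ.
  by rewrite /= -scalerDr normrZ (gtr0_norm t0) mulrBr.
have [h [lh hp]] := sublinear_dominates sp.
have h1 x : h x <= `|x|.
  by apply: (le_trans (hp x)); have := ple (0, 0) x C0; rewrite /= addr0 subr0.
have hN x : h (- x) = - h x.
  have h0 : h 0 = 0 by have := lh (-1) 0 0; rewrite scaler0 addr0 scaleN1r addNr.
  by have := lh (-1) x 0; rewrite addr0 h0 addr0 !scaleN1r.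
have h2 x : `|h x| <= 1 * `|x|.
  by rewrite mul1r ler_norml h1 andbT lerNl -hN -[leRHS]normrN h1.
exists (mk_dual lh h2); split.
  by apply: dual_norm_le => x x1; apply: le_trans (h2 x) _; rewrite mul1r.
move=> [w r] Cw /=; have := le_trans (hp (- w)) (ple (w, r) (- w) Cw).
by rewrite /= addNr normr0 sub0r hN lerN2.
Qed.

End sandwich.

(** * Sequences equivalent to the basis of l1 and alternating sums *)

Section reflexive_l1.
Context {R : realType} {X : normedModType R}.

(** Together with the upper bound coming from the triangle inequality, this is
    equivalence with the unit vector basis of l1. *)
Definition l1_like (u : nat -> X) (c : R) :=
  (forall l, `|u l| <= 1) /\
  forall n (a : nat -> R), c * \sum_(i < n) `|a i| <= `|\sum_(i < n) a i *: u i|.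

Lemma sum_pad (V : nmodType) m n (F : nat -> V) : (m <= n)%N ->
  \sum_(i < m) F i = \sum_(i < n) (if (i < m)%N then F i else 0).
Proof. by move=> mn; rewrite (big_ord_widen _ _ mn) big_mkcond. Qed.

(** The sandwich theorem on the dual provides [Phi] with [Phi f] at least the lower limit
    of [f (u l)].  If [Phi] were the evaluation at [x], then [x] would lie in the closed
    span of the sequence, as functionals vanishing on it are killed by [Phi]; but
    a functional vanishing on the first terms and at least [c] on the others
    separates [x] from its approximations. *)
Lemma reflexive_no_l1 (u : nat -> X) (c : R) :
  reflexive_space X -> 0 < c -> ~ l1_like u c.
Proof.
move=> reflX c0 [u1 uc].
pose C1 := [set d : dual X * R | forall r, r < d.2 -> exists N, forall l, (N <= l)%N -> r <= d.1 (u l)].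
have [||||Phi [_ HPhi]] := @sandwich R (dual X) C1.
- by move=> r /= r0; exists 0%N => l _; exact: ltW.
- move=> d e Hd He r /= rde.
  have [|N1 h1] := Hd (d.2 - (d.2 + e.2 - r) / 2); first by lra.
  have [|N2 h2] := He (e.2 - (d.2 + e.2 - r) / 2); first by lra.
  exists (maxn N1 N2) => l; rewrite geq_max => /andP[l1 l2].
  suff : r <= d.1 (u l) + e.1 (u l) by [].
  by have := h1 l l1; have := h2 l l2; lra.
- move=> t d t0 Hd r /= rt.
  have [|N h] := Hd (r / t); first by rewrite ltr_pdivrMr// mulrC.
  exists N => l /h; rewrite ler_pdivrMr// => hl.
  suff : r <= t * d.1 (u l) by [].
  by rewrite mulrC.
- move=> d Hd; rewrite leNgt; apply/negP => dd.
  have [|N h] := Hd ((`|d.1| + d.2) / 2); first by lra.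
  have := h N (leqnn _); have := le_trans (ler_norm _) (dual_le d.1 (u N)).
  have : `|d.1| * `|u N| <= `|d.1| by rewrite ler_piMr.
  lra.
have [x Hx] := reflX Phi.
have span e : 0 < e -> exists2 v, lin_span u v & `|x - v| <= e.
  move=> e0; apply: contrapT => no.
  pose C := [set d : X * R | exists t w, lin_span u w /\ d = (t *: x + w, t * e)].
  have sp0 : lin_span u 0 by exists 0%N, (fun=> 0); rewrite big_ord0.
  have [||||f [_ Hf]] := @sandwich R X C.
  - by exists 0, 0; rewrite scale0r addr0 mul0r.
  - move=> _ _ [t [w [sw ->]]] [s [z [sz ->]]] /=; exists (t + s), (w + z); split.
      by have := lin_span_submod 1 sw sz; rewrite scale1r.
    by rewrite scalerDl addrACA mulrDl.
  - move=> s _ s0 [t [w [sw ->]]] /=; exists (s * t), (s *: w); split.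
      by have := lin_span_submod s sw sp0; rewrite addr0.
    by rewrite scalerDr scalerA mulrA.
  - move=> _ [t [w [sw ->]]] /=; have [->|t0] := eqVneq t 0; first by rewrite mul0r.
    apply: (@le_trans _ _ (`|t| * e)); first by rewrite ler_wpM2r ?ler_norm// ltW.
    have -> : t *: x + w = t *: (x - (- t^-1) *: w).
      by rewrite scaleNr opprK scalerDr scalerA divff// scale1r.
    rewrite normrZ ler_wpM2l// leNgt; apply/negP => h; apply: no.
    exists (- t^-1 *: w); last exact: ltW.
    by have := lin_span_submod (- t^-1) sw sp0; rewrite addr0.
  have fx : e <= f x.
    have := Hf (x, e); apply; exists 1, 0; split=> //.
    by rewrite scale1r addr0 mul1r.
  have su l : lin_span u (u l).
    exists l.+1, (fun i => (i == l)%:R); rewrite big_ord_recr/= eqxx scale1r big1 ?add0r// => i _.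
    by rewrite ltn_eqF ?ltn_ord// scale0r.
  have fu l : f (u l) <= 0.
    have /= := Hf (- u l, 0); rewrite dualN oppr_ge0; apply; exists 0, (- u l); split.
      by have := lin_span_submod (-1) (su l) sp0; rewrite scaleN1r addr0.
    by rewrite scale0r add0r mul0r.
  have : 0 <= Phi (- f).
    have := HPhi (- f, 0); apply => r /= r0; exists 0%N => l _.
    apply: (le_trans (ltW r0)).
    suff : 0 <= - f (u l) by [].
    by rewrite oppr_ge0.
  by rewrite dualN oppr_ge0 Hx leNgt (lt_le_trans e0 fx).
have [|v [n [a va]] xv] := span (c / 4); first by rewrite divr_gt0.
pose C := [set d : X * R | exists m (b : nat -> R),
  d = (\sum_(i < m) b i *: u i, c * \sum_(i < m) (n <= i)%N%:R * b i)].
have [||||f [f1 Hf]] := @sandwich R X C.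
- by exists 0%N, (fun=> 0); rewrite !big_ord0 mulr0.
- move=> _ _ [m [b ->]] [m' [b' ->]] /=.
  exists (maxn m m'), (fun i => (if (i < m)%N then b i else 0) + (if (i < m')%N then b' i else 0)).
  rewrite (@sum_pad _ m (maxn m m') (fun i => b i *: u i)) ?leq_maxl//.
  rewrite (@sum_pad _ m' (maxn m m') (fun i => b' i *: u i)) ?leq_maxr//.
  rewrite (@sum_pad _ m (maxn m m') (fun i => (n <= i)%N%:R * b i)) ?leq_maxl//.
  rewrite (@sum_pad _ m' (maxn m m') (fun i => (n <= i)%N%:R * b' i)) ?leq_maxr//.
  rewrite -mulrDr -!big_split/=; congr (_, c * _); apply: eq_bigr => i _.
    by rewrite scalerDl; case: ifP; case: ifP; rewrite ?scale0r.
  by rewrite mulrDr; case: ifP; case: ifP; rewrite ?mulr0.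
- move=> t _ t0 [m [b ->]] /=; exists m, (fun i => t * b i); congr (_, _).
    by rewrite scaler_sumr; apply: eq_bigr => i _; rewrite scalerA.
  by rewrite mulrCA mulr_sumr; congr (_ * _); apply: eq_bigr => i _; rewrite mulrCA.
- move=> _ [m [b ->]] /=; apply: le_trans (uc m b); rewrite ler_wpM2l ?(ltW c0)//.
  apply: ler_sum => i _; apply: le_trans (ler_norm _) _.
  by rewrite normrM normr_nat ler_piMl// lern1 leq_b1.
have fv : f v <= 0.
  have /= := Hf (- v, 0); rewrite dualN oppr_ge0; apply; exists n, (fun i => - a i).
  congr (_, _); first by rewrite va -sumrN; apply: eq_bigr => i _; rewrite scaleNr.
  by rewrite big1 ?mulr0// => i _; rewrite leqNgt ltn_ord mul0r.
have fu l : (n <= l)%N -> c <= f (u l).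
  move=> nl; have := Hf (u l, c); apply; exists l.+1, (fun i => (i == l)%:R).
  rewrite !big_ord_recr/= eqxx nl scale1r mulr1 !big1 ?add0r ?mulr1// => i _.
    by rewrite ltn_eqF ?ltn_ord// mulr0.
  by rewrite ltn_eqF ?ltn_ord// scale0r.
have : c <= Phi f.
  have := HPhi (f, c); apply => r /= rc; exists n => l /fu.
  exact/le_trans/ltW.
rewrite Hx; have : f x <= c / 4 + f v.
  rewrite -lerBlDr -dualB; apply: le_trans (ler_norm _) _.
  by apply: le_trans (dual_le _ _) _; apply: le_trans xv; rewrite ler_piMl.
lra.
Qed.

End reflexive_l1.

Section chains.
Context {R : realType}.

(** Pigeonhole principle on a grid of mesh [eta]. *)
Lemma close_pair (u : nat -> nat -> R) (M eta : R) (m l0 : nat) :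
  0 < eta -> (forall l t, `|u l t| <= M) ->
  exists i j, [/\ (l0 <= i)%N, (i < j)%N &
    forall t, (t < m)%N -> `|u i t - u j t| <= eta].
Proof.
move=> e0 uM.
have M0 : 0 <= M by exact: le_trans (uM 0%N 0%N).
pose q l t := Num.truncn ((u l t + M) / eta).
pose B := (Num.truncn ((M + M) / eta)).+1.
have q0 l t : 0 <= (u l t + M) / eta.
  rewrite divr_ge0 ?(ltW e0)//; move: (uM l t); rewrite ler_norml; lra.
have qB l t : (q l t < B)%N.
  rewrite ltnS; apply: le_truncn; rewrite ler_pM2r ?invr_gt0// lerD2r.
  exact: le_trans (ler_norm _) (uM l t).
pose F (l : 'I_(#|{ffun 'I_m -> 'I_B}|.+1)) := [ffun t : 'I_m => Ordinal (qB (l0 + l)%N t)].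
have /injectivePn[l [l' ll' e]] : ~~ injectiveb F.
  apply/negP => /injectiveP /leq_card; by rewrite card_ord ltnn.
have close t : (t < m)%N -> `|u (l0 + l)%N t - u (l0 + l')%N t| <= eta.
  move=> tm; have := congr1 (fun g : {ffun 'I_m -> 'I_B} => g (Ordinal tm) : nat) e.
  rewrite !ffunE /= /q => qe.
  have /andP[a1 a2] := truncn_itv (q0 (l0 + l)%N t).
  have /andP[b1 b2] := truncn_itv (q0 (l0 + l')%N t).
  move: a1 a2; rewrite qe -natr1 => a1 a2; move: b2; rewrite -natr1 => b2.
  have {}a2 := lt_le_trans a2 (lerD b1 (lexx 1)).
  have {}b2 := lt_le_trans b2 (lerD a1 (lexx 1)).
  move: a2 b2; rewrite !ltr_pdivrMr// !mulrDl !mulfVK ?gt_eqF// !mul1r => a2 b2.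
  by rewrite ler_norml; apply/andP; split; lra.
case: (ltngtP l l') => [lt|lt|/val_inj]; last by move/eqP: ll'.
  by exists (l0 + l)%N, (l0 + l')%N; rewrite leq_addr ltn_add2l.
exists (l0 + l')%N, (l0 + l)%N; rewrite leq_addr ltn_add2l; split=> // t tm.
by rewrite distrC close.
Qed.

Definition chain_sum (X : zmodType) (u : nat -> X) (k : nat -> nat) (N : nat) : X :=
  \sum_(l < N) (u (k l.*2) - u (k l.*2.+1)).

(** A property of alternating sums can be propagated greedily, each new difference
    being taken as far as needed. *)
Lemma chain_exists (X : zmodType) (u : nat -> X) (P : nat -> X -> Prop) :
  P 0%N 0 ->
  (forall N v m, P N v -> exists i j, [/\ (m <= i)%N, (i < j)%N & P N.+1 (v + (u i - u j))]) ->
  forall N, exists k, {homo k : i j / (i < j)%N} /\ P N (chain_sum u k N).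
Proof.
move=> P0 PS; elim=> [|N [k [hk Pk]]].
  by exists id; split=> //; rewrite /chain_sum big_ord0.
have [i [j [ki ij Pj]]] := PS N _ (k N.*2).+1 Pk.
exists (fun t => if (t < N.*2)%N then k t else if t == N.*2 then i else (j + (t - N.*2.+1))%N).
split.
  apply: homo_ltn; first exact: ltn_trans.
  move=> t; case: (ltnP t N.*2) => t1; case: (ltnP t.+1 N.*2) => t2.
  - exact: hk.
  - have -> : t.+1 = N.*2 by apply/eqP; rewrite eqn_leq t1 t2.
    by rewrite eqxx (leq_trans _ ki)// ltnS ltnW// hk.
  - by move: (leq_trans t2 t1); rewrite ltnNge leqnSn.
  - rewrite (@gtn_eqF N.*2 t.+1 t1); case: eqP => [->|]; first by rewrite subnn addn0.
    by move=> /eqP tN; rewrite ltn_add2l ltn_sub2r// ltnS ltn_neqAle eq_sym tN t1.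
rewrite /chain_sum big_ord_recr/= ltnn eqxx ltnNge leqnSn/= gtn_eqF// subnn addn0.
congr (P _ (_ + _)) : Pj; apply: eq_bigr => l _.
by rewrite ltn_double ltn_ord ltn_Sdouble ltn_ord.
Qed.

End chains.

(** * Alternating sums in c0 and l1 *)

Section c0_l1_chains.
Context {R : realType}.

Lemma c0_norm_le (v : c0 R) r : (forall t, `|v t| <= r) -> `|v| <= r.
Proof. by move=> vr; apply: sup_norm_le => // ; exists 0%N. Qed.

Lemma c0_coord_le (v : c0 R) t : `|v t| <= `|v|.
Proof. exact: (le_sup_norm (c0_bounded v)). Qed.

(** Gliding hump: a new difference is tiny where the previous sum lives, and the
    previous sum is at most 1/2 where the new difference lives. *)
Lemma c0_chain (u : nat -> c0 R) (M : R) : (forall l, `|u l| <= M) ->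
  forall N, exists k, {homo k : i j / (i < j)%N} /\ `|chain_sum u k N| < 2 * M + 1.
Proof.
move=> uM; have M0 : 0 <= M by exact: le_trans (uM 0%N).
apply: (@chain_exists _ u (fun _ v => `|v| < 2 * M + 1)).
  by rewrite normr0; lra.
move=> N v l0 vM; pose eta := (2 * M + 1 - `|v|) / 2.
have eta0 : 0 < eta by rewrite divr_gt0// subr_gt0.
have [m Hm] : exists m, forall t, (m <= t)%N -> `|v t| <= 2^-1.
  case: v {vM eta eta0} => v /= hv; have /asboolP := hv.
  move=> /cvgrPdist_le/(_ 2^-1 ltac:(by rewrite invr_gt0))[m _ Hm].
  by exists m => t mt; have := Hm t mt; rewrite /= sub0r normrN.
have [i [j [li ij close]]] := @close_pair R (fun l t => u l t) M eta m l0 eta0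
  (fun l t => le_trans (c0_coord_le (u l) t) (uM l)).
exists i, j; split=> //.
apply: (@le_lt_trans _ _ (Num.max (`|v| + eta) (2 * M + 2^-1))); last first.
  by rewrite gt_max /eta; apply/andP; split; lra.
apply: c0_norm_le => t.
have -> : (v + (u i - u j)) t = v t + (u i t - u j t) :> R by [].
rewrite le_max; apply/orP; have [mt|tm] := leqP m t; [right|left]; last first.
  by apply: le_trans (ler_normD _ _) _; rewrite lerD ?c0_coord_le ?close.
apply: le_trans (ler_normD _ _) _; rewrite addrC lerD ?Hm//.
apply: le_trans (ler_normB _ _) _.
have := le_trans (c0_coord_le (u i) t) (uM i); have := le_trans (c0_coord_le (u j) t) (uM j).
by lra.
Qed.

Lemma l1_partial_le (v : l1 R) n : \sum_(t < n) `|v t| <= `|v|.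
Proof.
rewrite -(big_mkord xpredT (fun t => `|v t|)).
apply: nondecreasing_cvgn_le; last exact: l1_summable.
by apply/nondecreasing_seqP => m; rewrite /series/= big_nat_recr//= lerDl.
Qed.

Lemma l1_partial_ge (v : l1 R) (e : R) : 0 < e ->
  exists m, forall n, (m <= n)%N -> `|v| - e <= \sum_(t < n) `|v t|.
Proof.
move=> e0; have vl : series (fun n => `|v n|) @ \oo --> `|v| by exact: l1_summable.
have [m _ Hm] := (@cvgrPdist_le _ _ _ _ _ _ _).1 vl e e0.
exists m => n mn; have := Hm n mn; rewrite /= /series/= big_mkord ler_norml => /andP[_].
by rewrite lerBlDr -lerBlDl.
Qed.

(** Gliding hump: up to [d] the norms of the previous sum and of the new difference
    add up. *)
Lemma l1_chain (u : nat -> l1 R) (M d : R) : 0 < d -> (forall l, `|u l| <= M) ->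
  (forall i j, (i < j)%N -> 2 * d <= `|u i - u j|) ->
  forall N, exists k, {homo k : i j / (i < j)%N} /\ d * N%:R <= `|chain_sum u k N|.
Proof.
move=> d0 uM ud.
apply: (@chain_exists _ u (fun N v => d * N%:R <= `|v|)); first by rewrite mulr0.
move=> N v l0 vN; have d80 : 0 < d / 8 by rewrite divr_gt0.
have [m Hm] := l1_partial_ge v d80.
have em : 0 < d / 8 / m.+1%:R by rewrite divr_gt0.
have coord (w : l1 R) t : `|w t| <= `|w|.
  by apply: le_trans (l1_partial_le w t.+1); rewrite big_ord_recr/= lerDr sumr_ge0.
have [i [j [li ij close]]] := @close_pair R (fun l t => u l t) M _ m l0 em
  (fun l t => le_trans (coord (u l) t) (uM l)).
exists i, j; split=> //; set z := u i - u j.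
have zd : 2 * d <= `|z| by exact: ud.
have zm : \sum_(t < m) `|z t| <= d / 8.
  apply: (@le_trans _ _ (\sum_(t < m) (d / 8 / m.+1%:R))).
    by apply: ler_sum => t _; exact: close.
  rewrite sumr_const card_ord -[leLHS]mulr_natr mulrAC ler_pdivrMr// ler_pM2l//.
  by rewrite ler_nat.
have [n0 Hn0] := l1_partial_ge z d80.
pose n := (m + n0)%N.
have vz t : (v + z) t = v t + z t :> R by [].
apply: le_trans (l1_partial_le (v + z) n).
have big_split_n (w : l1 R) : \sum_(t < n) `|w t| = \sum_(t < m) `|w t| + \sum_(t < n0) `|w (m + t)%N|.
  by rewrite big_split_ord.
have h1 : \sum_(t < m) `|v t| - \sum_(t < m) `|z t| <= \sum_(t < m) `|(v + z) t|.
  by rewrite -sumrB; apply: ler_sum => t _; rewrite vz; exact: lerB_normD.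
have h2 : \sum_(t < n0) `|z (m + t)%N| - \sum_(t < n0) `|v (m + t)%N| <= \sum_(t < n0) `|(v + z) (m + t)%N|.
  by rewrite -sumrB; apply: ler_sum => t _; rewrite vz [leRHS](_ : _ = `|z (m + t)%N + v (m + t)%N|) ?lerB_normD// addrC.
have h3 := l1_partial_le v n; have h4 := Hn0 n (leq_addl _ _).
have h5 := Hm m (leqnn _).
move: h3 h4; rewrite !big_split_n -[N.+1%:R]natr1 mulrDr mulr1.
lra.
Qed.

End c0_l1_chains.

(** * Block sequences that realise a spreading model *)

Section block_model.
Context {R : realType} {Y : normedModType R}.
Variables (D : nat -> Y) (sg : nat -> nat) (b : nat -> nat -> R).

(** The norms of combinations of [D] are the asymptotic norms of the combinations
    of the blocks [b] with the same coefficients, expressed without a supremum. *)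
Definition block_model := forall n (e : R), 0 < e -> exists T,
  forall (a : nat -> R) (k : nat -> nat), (forall i, `|a i| <= 1) ->
  {homo k : i j / (i < j)%N} -> (T <= k 0)%N ->
  normle (fun t => \sum_(i < n) `|a i| * b (k i) t) (`|\sum_(i < n) a i *: D i| + e) /\
  forall r, normle (fun t => \sum_(i < n) `|a i| * b (k i) t) r ->
    `|\sum_(i < n) a i *: D i| <= r + e.

Hypotheses (bB : blocks sg b) (sgl : forall l, (l <= sg l)%N) (model : block_model).

(** The fundamental function of [D]. *)
Definition sum_norm n : R := `|\sum_(i < n) D i|.

Let b0 l t : 0 <= b l t. Proof. by have [_ /(_ l t)[]] := bB. Qed.

Lemma sum_norm_ge0 n : 0 <= sum_norm n. Proof. exact: normr_ge0. Qed.

Lemma sum_norm0 : sum_norm 0 = 0. Proof. by rewrite /sum_norm big_ord0 normr0. Qed.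

Lemma model_bdd n (e C : R) : 0 < e -> 0 < C -> exists T,
  forall (a : nat -> R) (k : nat -> nat), (forall i, `|a i| <= C) ->
  {homo k : i j / (i < j)%N} -> (T <= k 0)%N ->
  normle (fun t => \sum_(i < n) `|a i| * b (k i) t) (`|\sum_(i < n) a i *: D i| + e) /\
  forall r, normle (fun t => \sum_(i < n) `|a i| * b (k i) t) r ->
    `|\sum_(i < n) a i *: D i| <= r + e.
Proof.
move=> e0 C0; have [T HT] := model n (divr_gt0 e0 C0).
exists T => a k aC hk Tk; have CN : `|C| = C by rewrite gtr0_norm.
have a1 i : `|C^-1 * a i| <= 1.
  by rewrite normrM normfV CN mulrC ler_pdivrMr// mul1r.
have [h1 h2] := HT (fun i => C^-1 * a i) k a1 hk Tk.
have eD : \sum_(i < n) (C^-1 * a i) *: D i = C^-1 *: \sum_(i < n) a i *: D i.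
  by rewrite scaler_sumr; apply: eq_bigr => i _; rewrite scalerA.
have eb : (fun t => \sum_(i < n) `|C^-1 * a i| * b (k i) t) =
    (fun t => C^-1 * \sum_(i < n) `|a i| * b (k i) t).
  apply/funext => t; rewrite mulr_sumr; apply: eq_bigr => i _.
  by rewrite normrM normfV CN mulrA.
rewrite eD normrZ normfV CN eb in h1 h2; split.
  have := normleZ C h1; rewrite CN mulrDr mulVKf ?gt_eqF// mulrCA divff ?gt_eqF// mulr1.
  by apply: normle_dom => t; rewrite mulVKf ?gt_eqF.
move=> r hr; have := h2 _ (normleZ C^-1 hr).
by rewrite normfV CN ![C^-1 * _]mulrC -mulrDl ler_pM2r ?invr_gt0.
Qed.

(** Increasing enumeration of the indices below [N] satisfying [A]. *)
Lemma pick_enum (A : pred nat) N : exists (k : nat -> nat),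
  [/\ {homo k : i j / (i < j)%N}, forall j, (j < count A (iota 0 N))%N -> (k j < N)%N &
  forall (V : nmodType) (F : nat -> V),
    \sum_(i < N | A i) F i = \sum_(j < count A (iota 0 N)) F (k j)].
Proof.
elim: N => [|N [k [hk kN kF]]]; first by exists id; split=> // V F; rewrite !big_ord0.
have sizeE : count A (iota 0 N.+1) = (count A (iota 0 N) + A N)%N.
  by rewrite -addn1 iotaD count_cat/= add0n addn0.
set n := count A (iota 0 N) in kN kF sizeE.
case AN : (A N); rewrite AN ?addn1 ?addn0 in sizeE; rewrite sizeE; last first.
  exists k; split=> // [j jn|V F]; first exact: ltnW (kN j jn).
  by rewrite big_mkcond big_ord_recr/= AN addr0 -big_mkcond kF.
exists (fun j => if (j < n)%N then k j else (N + (j - n))%N); split.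
- apply: homo_ltn; first exact: ltn_trans.
  move=> j; case: (ltnP j n) => jn; case: (ltnP j.+1 n) => jn'.
  + exact: hk.
  + by apply: leq_trans (kN j jn) (leq_addr _ _).
  + by move: (leq_trans jn' jn); rewrite ltnNge leqnSn.
  + by rewrite ltn_add2l ltn_sub2r.
- move=> j; rewrite ltnS leq_eqVlt => /orP[/eqP->|jn].
    by rewrite ltnn subnn addn0.
  by rewrite jn; exact: ltnW (kN j jn).
- move=> V F; rewrite big_mkcond big_ord_recr/= AN -big_mkcond/= kF.
  rewrite big_ord_recr/= ltnn subnn addn0; congr (_ + _).
  by apply: eq_bigr => j _; rewrite ltn_ord.
Qed.

Lemma sum_indicator (V : lmodType R) (A : pred nat) N (F : nat -> V) :
  \sum_(i < N) (A i)%:R *: F i = \sum_(i < N | A i) F i.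
Proof.
by rewrite [RHS]big_mkcond; apply: eq_bigr => i _; case: (A i); rewrite ?scale1r ?scale0r.
Qed.

(** Spreading invariance of [D]: both sums are modelled by the same sums of blocks. *)
Lemma norm_sum_pick (A : pred nat) N :
  `|\sum_(i < N | A i) D i| = sum_norm (count A (iota 0 N)).
Proof.
have [kap [hkap _ kF]] := pick_enum A N; set n := count A (iota 0 N) in kF *.
have ind (C : pred nat) i : `|(C i)%:R : R| <= 1 by rewrite normr_nat lern1 leq_b1.
have eD : \sum_(i < N) (A i)%:R *: D i = \sum_(i < N | A i) D i by rewrite sum_indicator.
have eD' : \sum_(i < n) (predT i)%:R *: D i = \sum_(i < n) D i.
  by apply: eq_bigr => i _; rewrite /= scale1r.
have same (k : nat -> nat) t : \sum_(i < N) `|(A i)%:R| * b (k i) t = \sum_(i < n) `|(predT i)%:R| * b (k (kap i)) t.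
  transitivity (\sum_(i < n) b (k (kap i)) t); last first.
    by apply: eq_bigr => i _; rewrite /= normr1 mul1r.
  rewrite -(kF _ (fun i => b (k i) t)) [RHS]big_mkcond; apply: eq_bigr => i _.
  by case: (A i); rewrite ?normr1 ?normr0 ?mul1r ?mul0r.
apply/eqP; rewrite eq_le; apply/andP; split; apply/ler_addgt0Pr => e e0.
  have e20 : 0 < e / 2 by rewrite divr_gt0.
  have [T1 H1] := model N e20; have [T2 H2] := model n e20.
  pose k i := (T1 + T2 + i)%N.
  have hk : {homo k : i j / (i < j)%N} by move=> i j; rewrite ltn_add2l.
  have [|h1 h2] := H1 _ k (ind A) hk; first by rewrite /k addn0 leq_addr.
  have [||h3 h4] := H2 _ (k \o kap) (ind predT).
  - by move=> i j ij; apply/hk/hkap.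
  - by rewrite /= /k -addnA addnCA leq_addr.
  rewrite eD eD' in h1 h2 h3 h4.
  apply: le_trans (h2 (sum_norm n + e / 2) _) _; last by rewrite /sum_norm -addrA -splitr.
  apply: normle_dom h3 => t; rewrite same/=; exact: lexx.
have e20 : 0 < e / 2 by rewrite divr_gt0.
have [T1 H1] := model N e20; have [T2 H2] := model n e20.
pose k i := (T1 + T2 + i)%N.
have hk : {homo k : i j / (i < j)%N} by move=> i j; rewrite ltn_add2l.
have [|h1 h2] := H1 _ k (ind A) hk; first by rewrite /k addn0 leq_addr.
have [||h3 h4] := H2 _ (k \o kap) (ind predT).
- by move=> i j ij; apply/hk/hkap.
- by rewrite /= /k -addnA addnCA leq_addr.
rewrite eD eD' in h1 h2 h3 h4.
apply: le_trans (h4 _ _) _; last by rewrite [leRHS](_ : _ = `|\sum_(i < N | A i) D i| + e / 2 + e / 2) // -addrA -splitr.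
by apply: normle_dom h1 => t; rewrite same.
Qed.

Lemma model_pick n (e : R) : 0 < e -> exists T,
  forall (A : pred nat) (k : nat -> nat),
  {homo k : i j / (i < j)%N} -> (T <= k 0)%N ->
  normle (fun t => \sum_(i < n | A i) b (k i) t) (sum_norm (count A (iota 0 n)) + e) /\
  forall r, normle (fun t => \sum_(i < n | A i) b (k i) t) r ->
    sum_norm (count A (iota 0 n)) <= r + e.
Proof.
move=> e0; have [T HT] := model n e0; exists T => A k hk Tk.
have [|h1 h2] := HT (fun i => (A i)%:R) k _ hk Tk.
  by move=> i; rewrite normr_nat lern1 leq_b1.
rewrite sum_indicator norm_sum_pick in h1 h2.
have same : (fun t => \sum_(i < n) `|(A i)%:R| * b (k i) t) = (fun t => \sum_(i < n | A i) b (k i) t).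
  apply/funext => t; rewrite [RHS]big_mkcond; apply: eq_bigr => i _.
  by case: (A i); rewrite ?normr1 ?normr0 ?mul1r ?mul0r.
by rewrite same in h1 h2.
Qed.

Lemma model_all n (e : R) : 0 < e -> exists T,
  forall (k : nat -> nat), {homo k : i j / (i < j)%N} -> (T <= k 0)%N ->
  normle (fun t => \sum_(i < n) b (k i) t) (sum_norm n + e) /\
  forall r, normle (fun t => \sum_(i < n) b (k i) t) r -> sum_norm n <= r + e.
Proof.
move=> e0; have [T HT] := model_pick n e0; exists T => k hk Tk.
by have := HT predT k hk Tk; rewrite count_predT size_iota.
Qed.

Lemma sum_norm_mono m n : (m <= n)%N -> sum_norm m <= sum_norm n.
Proof.
move=> mn; apply/ler_addgt0Pr => e e0; have e20 : 0 < e / 2 by rewrite divr_gt0.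
have [T1 H1] := model_all m e20; have [T2 H2] := model_all n e20.
pose k i := (T1 + T2 + i)%N.
have hk : {homo k : i j / (i < j)%N} by move=> i j; rewrite ltn_add2l.
have [|_ h1] := H1 k hk; first by rewrite /k addn0 leq_addr.
have [|h2 _] := H2 k hk; first by rewrite /k addn0 leq_addl.
apply: (le_trans (h1 _ _)); last by rewrite [X in _ <= _ + X]splitr addrA.
apply: normle_dom h2 => t; rewrite !ger0_norm ?sumr_ge0//.
exact: (@sum_nonneg_mono _ (fun i => b (k i) t)).
Qed.

Lemma norm_shift_le m n : `|\sum_(i < n) D (m + i)| <= sum_norm n.
Proof.
have -> : \sum_(i < n) D (m + i) = \sum_(i < m + n | (m <= i)%N) D i.
  rewrite [RHS]big_mkcond [RHS]big_split_ord/= [X in _ = X + _]big1 ?add0r => [|i _].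
    by apply: eq_bigr => i _; rewrite leq_addr.
  by rewrite leqNgt ltn_ord.
rewrite (norm_sum_pick (leq m)); apply: sum_norm_mono.
rewrite iotaD count_cat add0n -[leqRHS]add0n -[n in leqRHS](size_iota m n) leq_add ?count_size//.
rewrite (@eq_in_count _ _ pred0) ?count_pred0// => i; rewrite mem_iota add0n => /andP[_ im].
by rewrite leqNgt im.
Qed.

Lemma sum_normD m n : sum_norm (m + n) <= sum_norm m + sum_norm n.
Proof.
rewrite {1}/sum_norm big_split_ord/=; apply: (le_trans (ler_normD _ _)).
by rewrite lerD2l norm_shift_le.
Qed.

Lemma sum_norm_le_linear t x : (0 < t)%N -> sum_norm x <= (x%:R / t%:R + 1) * sum_norm t.
Proof.
move=> t0; have mul u : sum_norm (u * t) <= u%:R * sum_norm t.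
  elim: u => [|u IH]; first by rewrite mul0n sum_norm0 mul0r.
  by rewrite mulSn (le_trans (sum_normD _ _))// -[u.+1%:R]nat1r mulrDl mul1r lerD2l.
apply: (@le_trans _ _ (sum_norm ((x %/ t).+1 * t))).
  by apply: sum_norm_mono; rewrite ltnW// ltn_ceil.
apply: (le_trans (mul _)); rewrite ler_wpM2r ?sum_norm_ge0// -natr1 lerD2r.
by rewrite ler_pdivlMr ?ltr0n// -natrM ler_nat leq_trunc_div.
Qed.

Lemma sum_norm_pieces_ge K : weight K * (pieces K)%:R * sum_norm 1 <= sum_norm (pieces K).
Proof.
apply/ler_addgt0Pr => e e0.
set w := weight K * (pieces K)%:R.
have w0 : 0 < w by rewrite mulr_gt0 ?weight_gt0// ltr0n pieces_gt0.
have d0 : 0 < e / 2 / (w * 2) by rewrite !divr_gt0// mulr_gt0.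
have e20 : 0 < e / 2 by rewrite divr_gt0.
set d := e / 2 / (w * 2) in d0.
have [T1 H1] := model_all (pieces K) e20; have [T2 H2] := model_all 1 d0.
pose k i := (T1 + T2 + K.+1 + i)%N.
have hk : {homo k : i j / (i < j)%N} by move=> i j; rewrite ltn_add2l.
have [|h1 _] := H1 k hk; first by rewrite /k; lia.
have one j r : normle (b (k j)) r -> sum_norm 1 <= r + d.
  move=> hr; have [||_ h2] := H2 (fun i => k (j + i)%N).
  - by move=> i i' ii'; apply: hk; rewrite ltn_add2l.
  - by rewrite /k; lia.
  by apply: h2; apply: normle_dom hr => t; rewrite big_ord1 addn0.
have [hsg hb] := bB.
pose c j := sg (k j).
have hc : {homo c : i j / (i <= j)%N} by move=> i j ij; apply: hsg; exact: (ltnW_homo hk).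
have Kc : (K < c 0)%N by apply: leq_trans (sgl _); rewrite /k; lia.
have := @layer_lower _ K c _ (sum_norm 1 - d * 2) _ hc Kc _ h1.
move=> /(_ _)/wrap[].
  move=> j jK hj; suff : sum_norm 1 <= sum_norm 1 - d * 2 + d by lra.
  apply: (one j); apply: normle_dom hj => t.
  have [->|bt] := eqVneq (b (k j) t) 0; first by rewrite normr0.
  have /andP[t1 t2] := (hb (k j) t).2 bt.
  rewrite /c t1 (leq_trans t2) ?hsg// ?hk// mul1r !ger0_norm ?sumr_ge0//.
  by rewrite (bigD1 (Ordinal jK))//= lerDl sumr_ge0.
rewrite -/w mulrBr => h; have wd : w * (d * 2) = e / 2.
  by rewrite [d * 2]mulrC mulrA mulrC /d divfK// mulf_neq0// gt_eqF.
lra.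
Qed.

End block_model.

(** * Growth of the sums in a spreading model *)

Section block_model_l1.
Context {R : realType} {Y : normedModType R}.
Variables (D : nat -> Y) (sg : nat -> nat) (b : nat -> nat -> R).
Hypotheses (bB : blocks sg b) (sgl : forall l, (l <= sg l)%N).
Hypothesis model : block_model D b.

Let b0 l t : 0 <= b l t. Proof. by have [_ /(_ l t)[]] := bB. Qed.

Lemma sum_regroup (V : nmodType) m r (F : nat -> V) :
  \sum_(i < m * r) F i = \sum_(l < m) \sum_(j < r) F (l * r + j)%N.
Proof.
elim: m => [|m IH]; first by rewrite !big_ord0.
by rewrite mulSnr big_split_ord/= big_ord_recr/= IH.
Qed.

(** Otherwise let [L > 0] be the infimum of the averages of [sum_norm].  Averages
    of the blocks over long consecutive stretches of a length [r] that almost attains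
    [L] form a flat sequence, since longer sums cannot be relatively smaller. *)
Lemma sum_norm_sublinear (d : R) : 0 < d -> exists n, (0 < n)%N /\ sum_norm D n < d * n%:R.
Proof.
move=> d0; apply: contrapT => no.
have dn n : (0 < n)%N -> d <= sum_norm D n / n%:R.
  move=> n0; rewrite ler_pdivlMr ?ltr0n// leNgt; apply/negP => h.
  by apply: no; exists n.
pose A := [set sum_norm D n / n%:R | n in [set n | (0 < n)%N]].
have iA : has_inf A.
  by split; [exists (sum_norm D 1 / 1%:R), 1%N|exists d => _ [n n0 <-]; exact: dn].
pose L := inf A.
have L0 : 0 < L.
  by apply: lt_le_trans d0 _; apply: lb_le_inf; [exact: iA.1|move=> _ [n n0 <-]; exact: dn].
have Ln n : L * n%:R <= sum_norm D n.
  have [->|n0] := posnP n; first by rewrite mulr0 sum_norm_ge0.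
  by rewrite -ler_pdivlMr ?ltr0n//; apply: ge_inf; [exact: iA.2|exists n].
have [_ [r /= r0 <-]] : exists2 x, A x & x < L + L / 10.
  by apply: inf_adherent => //; rewrite divr_gt0.
have rR : 0 < r%:R :> R by rewrite ltr0n.
rewrite ltr_pdivrMr// => rL.
have e0 : 0 < L * r%:R / 10 by rewrite divr_gt0// mulr_gt0.
have [T0 H0] := model_all model r e0.
(* 6/5 leaves room for the excess of the average at r over L and for the error of
   the model, and stays below 4/3, so that the normalised averages are flat. *)
pose C := 6 / 5 * L * r%:R.
have C0 : 0 < C by rewrite !mulr_gt0// divr_gt0.
pose y l t := C^-1 * \sum_(i < r) b ((T0 + l) * r + i)%N t.
pose sg' l := sg ((T0 + l) * r)%N.
have [hsg hb] := bB.
have yB : blocks sg' y.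
  split=> [i j ij|l t]; first by apply: hsg; rewrite leq_mul2r leq_add2l ij orbT.
  split; first by rewrite mulr_ge0 ?invr_ge0 ?(ltW C0)// sumr_ge0.
  move=> yn; have [i bi] : exists i : 'I_r, b ((T0 + l) * r + i)%N t != 0.
    apply: contrapT => ni; move: yn; rewrite /y big1 ?mulr0 ?eqxx// => i _.
    by apply: contrapT => bi; apply: ni; exists i; exact/eqP.
  have /andP[t1 t2] := (hb _ _).2 bi; apply/andP; split.
    by apply: leq_trans t1; apply: hsg; exact: leq_addr.
  apply: (leq_trans t2); apply: hsg.
  by rewrite addnS mulSn [leqRHS]addnC -addnS leq_add2l.
apply: (no_flat_blocks yB) => [l|m m0|l].
- have [||h _] := H0 (fun i => (T0 + l) * r + i)%N.
  + by move=> i j; rewrite ltn_add2l.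
  + by rewrite addn0 (leq_trans (leq_addr l _))// leq_pmulr.
  have CN : `|C^-1| = C^-1 by rewrite gtr0_norm// invr_gt0.
  apply: normle_le (normleZ C^-1 h); rewrite CN mulrC ler_pdivrMr// mul1r /C; lra.
- have e1 : 0 < L * (m * r)%:R / 20 by rewrite divr_gt0// mulr_gt0// ltr0n muln_gt0 m0.
  have [T HT] := model_all model (m * r) e1.
  exists T => k hk Tk h.
  pose kap i := ((T0 + k (i %/ r)) * r + i %% r)%N.
  have hkap : {homo kap : i j / (i < j)%N}.
    move=> i j ij; rewrite /kap; have := leq_div2r r (ltnW ij).
    rewrite leq_eqVlt => /orP[/eqP e|lt].
      by rewrite e ltn_add2l; move: ij; rewrite {1}(divn_eq i r) {1}(divn_eq j r) e ltn_add2l.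
    apply: (@leq_trans ((T0 + k (i %/ r)).+1 * r)%N); first by rewrite mulSnr ltn_add2l ltn_mod.
    apply: leq_trans (leq_addr _ _); rewrite leq_mul2r -addnS leq_add2l; apply/orP; right.
    exact: hk.
  have [|_ h2] := HT kap hkap.
    rewrite /kap div0n mod0n addn0; apply: leq_trans Tk _.
    by apply: leq_trans (leq_addl T0 _) _; rewrite leq_pmulr.
  have : sum_norm D (m * r) <= C * (3 / 4 * m%:R) + L * (m * r)%:R / 20.
    apply: h2; have := normleZ C h; rewrite (gtr0_norm C0).
    apply: normle_dom => t; rewrite (sum_regroup m r (fun i => b (kap i) t)) -mulr_sumr mulVKf ?gt_eqF//.
    rewrite le_eqVlt; apply/orP; left; apply/eqP; congr `|_|; apply: eq_bigr => l _.
    by apply: eq_bigr => j _; rewrite /kap divnMDl// modnMDl divn_small// addn0 modn_small.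
  have := Ln (m * r)%N; rewrite natrM /C.
  have : 0 < L * (m%:R * r%:R) by rewrite !mulr_gt0// ltr0n.
  move: (sum_norm D _) => p; nra.
- by apply: leq_trans (sgl _); rewrite (leq_trans (leq_addl T0 _))// leq_pmulr.
Qed.

Hypothesis phi1 : 0 < sum_norm D 1.

(** If multiplying the length by [2 ^ a] always lost a factor 3/4, the averages of
    [sum_norm] would decay like a power, below the lower bound given by the layer [6 a]; the number
    [2 ^ (36 a ^ 2)] of its intervals is a power of [2 ^ a]. *)
Lemma growth a : (0 < a)%N -> exists t, (0 < t)%N /\
  3 / 4 * (2 ^ a)%:R * sum_norm D t <= sum_norm D (2 ^ a * t).
Proof.
move=> a0; apply: contrapT => no; set q := (2 ^ a)%N in no.
have qR : 0 <= 3 / 4 * q%:R :> R by rewrite mulr_ge0// divr_ge0.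
have step s : sum_norm D (q ^ s) <= (3 / 4 * q%:R) ^+ s * sum_norm D 1.
  elim: s => [|s IH]; first by rewrite expr0 mul1r.
  rewrite expnS exprS -mulrA; apply: le_trans _ (ler_wpM2l qR IH).
  rewrite leNgt; apply/negP => h; apply: no; exists (q ^ s)%N; split.
    by rewrite !expn_gt0.
  exact: ltW.
have lenE : pieces (6 * a) = (q ^ (36 * a))%N.
  by rewrite /pieces /q -expnM; congr (2 ^ _)%N; nia.
have := le_trans (sum_norm_pieces_ge bB sgl model (6 * a)) _; rewrite lenE => /(_ _ (step _)).
rewrite ler_pM2r// exprMn natrX ler_pM2r ?exprn_gt0 ?ltr0n ?expn_gt0//.
have -> : (36 * a = 3 * (12 * a))%N by lia.
rewrite exprM leNgt => /negP[].
apply: (@le_lt_trans _ _ (2^-1 ^+ (12 * a))).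
  by rewrite lerXn2r ?nnegrE//; [lra..|]; rewrite !exprS expr0; lra.
rewrite /weight ltr_iXn2l ?invr_gt0// ?invf_lt1 ?ltr1n//; lia.
Qed.

(** [sum_norm] is at most affine with slope [sum_norm D t / t], and the scale is so
    long compared with [t] and the number of intervals of layer [K] that the constant
    term is negligible.  Half of the sum is then below 69/100 of the whole. *)
Lemma flat_scale K : exists h t, [/\ (0 < t)%N,
  256 * sum_norm D 1 <= sum_norm D (h + h),
  (h%:R / t%:R + 1) * sum_norm D t <= 69 / 100 * sum_norm D (h + h),
  h%:R / t%:R * sum_norm D t <= 2 / 3 * sum_norm D (h + h) &
  12 * (pieces K)%:R * sum_norm D t <= sum_norm D (h + h)].
Proof.
(* The summand K ^ 2 makes the scale dominate the intervals of layer K; the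
   constant 23 makes room for the intervals of layer 4 and the numerical slack. *)
pose a := (K ^ 2 + 23)%N.
have [t [t0 gr]] := @growth a.+1 (ltn0Sn _).
have p0 : 0 <= sum_norm D t by exact: sum_norm_ge0.
have tR : 0 < t%:R :> R by rewrite ltr0n.
exists (2 ^ a * t)%N, t.
have -> : (2 ^ a * t + 2 ^ a * t = 2 ^ a.+1 * t)%N by rewrite expnS; nia.
have q64 : 64 <= (2 ^ a.+1)%:R :> R.
  by rewrite ler_nat (_ : 64 = 2 ^ 6)%N// leq_pexp2l// /a addnC.
have qlen : 16 * (pieces K)%:R <= (2 ^ a.+1)%:R :> R.
  rewrite -natrM ler_nat (_ : 16 = 2 ^ 4)%N// -expnD leq_pexp2l// /a.
  by rewrite addnC -addnS leq_add2l.
have hE : (2 ^ a * t)%:R / t%:R = (2 ^ a.+1)%:R / 2 :> R.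
  by rewrite expnS !natrM mulfK ?gt_eqF// mulrAC divff// mul1r.
have l4 : (pieces 4 <= 2 ^ a.+1 * t)%N.
  rewrite /pieces; apply: leq_trans (leq_pmulr _ t0); rewrite leq_pexp2l// /a.
  by rewrite addnC -addSn (leq_trans _ (leq_addr _ _)).
have P256 := le_trans (sum_norm_pieces_ge bB sgl model 4) (sum_norm_mono bB model l4).
rewrite hE; move: gr q64 qlen P256 p0.
have -> : weight 4 * (pieces 4)%:R = 256 :> R.
  have -> : (pieces 4)%:R = 2 ^+ 16 :> R by rewrite /pieces natrX.
  rewrite /weight (_ : 4 + 4 = 8)%N// (_ : 16 = 8 + 8)%N// (exprD 2 8 8) exprVn mulKf ?expf_neq0//.
  by rewrite !exprS expr0; lra.
move: (2 ^ a.+1)%:R (sum_norm D t) (sum_norm D (2 ^ a.+1 * t)) (pieces K)%:R (sum_norm D 1) => q p P l p1.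
move=> gr q64 ql P1 p0.
have p64 : 64 * p <= q * p by rewrite ler_wpM2r.
have plen : 16 * l * p <= q * p by rewrite ler_wpM2r.
split=> //; lra.
Qed.

(** Fixing the first half of the sum bounds the parameter of every norming
    functional, while neither half alone nor the layers below [K] can account
    for the norm of the whole. *)
Lemma normed_window K : exists B M (cf : R) T,
  [/\ (K <= B)%N, 0 < cf, cf * sum_norm D M <= 1 & forall k, {homo k : i j / (i < j)%N} ->
    (T <= k 0)%N -> exists c g n, admissible c g /\
    8^-1 <= \sum_(i < n) layers K B c g i * (cf * \sum_(l < M) b (k l) i)].
Proof.
have [h [t [t0 P256 phih phih' plen]]] := flat_scale K.
pose N := (h + h)%N; rewrite -/N in P256 phih phih' plen.
set p := sum_norm D t in phih phih' plen; set P := sum_norm D N in P256 phih phih' plen.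
have p0 : 0 <= p by exact: sum_norm_ge0.
have tR : 0 < t%:R :> R by rewrite ltr0n.
have P0 : 0 < P by apply: lt_le_trans P256; rewrite mulr_gt0 ?ltr0n.
have lenR : 1 <= (pieces K)%:R :> R by rewrite ler1n pieces_gt0.
(* In the bound for the low layers the error of the model is multiplied by the number
   of intervals of layer K. *)
pose e := P / 100 / (pieces K)%:R.
have e0 : 0 < e by rewrite !divr_gt0// (lt_le_trans ltr01 lenR).
have elen : (pieces K)%:R * e = P / 100 by rewrite /e mulrC divfK// gt_eqF// (lt_le_trans ltr01 lenR).
have eP : e <= P / 100 by rewrite -elen ler_peMl// ltW.
have lin x : sum_norm D x <= (x%:R / t%:R + 1) * p by exact: (sum_norm_le_linear bB model).
have {phih}phih := le_trans (lin h) phih.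
have [TN HN] := model_all model N e0.
have [Th Hh] := model_pick model h e0.
have [T1 H1] := model_all model 1 e0.
pose T := (TN + Th + T1)%N.
have TNT : (TN <= T)%N by rewrite /T -addnA leq_addr.
have ThT : (Th <= T)%N by rewrite /T addnAC leq_addl.
have T1T : (T1 <= T)%N by rewrite /T leq_addl.
pose B := maxn K (sg (T + h)).
have [hsg hb] := bB.
exists B, h, P^-1, (T + h)%N; split.
- exact: leq_maxl.
- by rewrite invr_gt0.
- by rewrite mulrC ler_pdivrMr// mul1r; apply: (sum_norm_mono bB model); exact: leq_addr.
move=> k hk Tk.
pose k' i := if (i < h)%N then (T + i)%N else k (i - h)%N.
have kk i : (T + h + i <= k i)%N.
  by elim: i => [|i IH]; rewrite ?addn0// addnS; exact: leq_ltn_trans (hk i i.+1 (ltnSn i)).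
have hk' : {homo k' : i j / (i < j)%N}.
  move=> i j ij; rewrite /k'; case: (ltnP j h) => jh; case: (ltnP i h) => ih.
  - by rewrite ltn_add2l.
  - by move: (leq_ltn_trans ih ij); rewrite ltnNge ltnW.
  - by apply: leq_trans (kk _); rewrite -addnA -addnS leq_add2l (leq_trans ih)// leq_addr.
  - by apply: hk; rewrite ltn_sub2r// (leq_ltn_trans ih ij).
have Tk' : (T <= k' 0)%N.
  by rewrite /k'; case: ifP => _; rewrite ?addn0// sub0n (leq_trans (leq_addr h _)).
have hT : {homo (fun i => T + i)%N : i j / (i < j)%N} by move=> i j; rewrite ltn_add2l.
pose x1 i := \sum_(l < h) b (T + l)%N i; pose x2 i := \sum_(l < h) b (k l) i.
have x12 i : \sum_(l < N) b (k' l) i = x1 i + x2 i.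
  rewrite /N big_split_ord/=; congr (_ + _); apply: eq_bigr => l _; rewrite /k'.
    by rewrite ltn_ord.
  by rewrite ltnNge leq_addr/= addKn.
have nh k'' : {homo k'' : i j / (i < j)%N} -> (T <= k'' 0)%N ->
    normle (fun i => \sum_(l < h) b (k'' l) i) (70 / 100 * P).
  move=> h'' T''; have [|hh _] := Hh predT k'' h''; first exact: leq_trans T''.
  by apply: normle_le hh; rewrite count_predT size_iota; move: phih eP; lra.
have coord l i : (T <= l)%N -> b l i <= P / 2.
  move=> Tl; have [||h1 _] := H1 (fun i => l + i)%N.
  - by move=> u v; rewrite ltn_add2l.
  - by rewrite addn0; exact: leq_trans Tl.
  have := normle_coord i h1; rewrite big_ord1 addn0 ger0_norm// => h2.
  by apply: (le_trans h2); move: P256 eP phi1; lra.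
have bk := blocks_sub bB hk.
have [||||||||||c [g [n [cg v]]]] := @window R x1 x2 (70 / 100 * P) (70 / 100 * P) (98 / 100 * P)
   (8^-1 * (2 / 3 * P + P / 6 + P / 100)) K B.
- by move=> i; exact: sumr_ge0.
- by move=> i; exact: sumr_ge0.
- move=> i; apply: contraNT; rewrite -leqNgt => Bi.
  rewrite /x1 big1// => l _; apply/eqP; apply: contraTT (Bi) => bl.
  have /andP[_ h1] := (hb (T + l)%N i).2 bl.
  rewrite -ltnNge leq_max; apply/orP; right; apply: (leq_trans h1).
  by rewrite hsg// -addnS leq_add2l.
- by apply: (nh (fun i => T + i)%N) => //; rewrite addn0.
- by apply: nh => //; exact: leq_trans (leq_addr h _) Tk.
- by move: P0; lra.
- move=> i; rewrite -x12; apply: (@le_trans _ _ (P / 2)); last by move: P0; lra.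
  apply: (blocks_coord _ (blocks_sub bB hk')); first by rewrite divr_ge0// ltW.
  move=> l /=; apply: coord; apply: (leq_trans Tk').
  by have := ltnW_homo hk' (leq0n l).
- exact: leq_maxl.
- move=> c g n K' cg KK'.
  have pt0 : 0 <= p / t%:R by rewrite divr_ge0// ltW.
  have pe0 : 0 <= p + e by rewrite addr_ge0// ltW.
  have HA (A : {set 'I_h}) : normle (fun i => \sum_(l in A) (b \o k) l i) (p / t%:R * #|A|%:R + (p + e)).
    pose A' j := oapp (mem A) false (insub j).
    have A'E (l : 'I_h) : A' l = (l \in A) by rewrite /A' valK.
    have cA : count A' (iota 0 h) = #|A|.
      rewrite -sum1_count -[h in iota 0 h]subn0 -/(index_iota 0 h) big_mkord -sum1_card.
      by apply: eq_bigl => l; rewrite A'E.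
    have [|hh _] := Hh A' k hk; first by apply: leq_trans ThT (leq_trans (leq_addr h _) Tk).
    rewrite cA in hh; apply: normle_le (_ : normle _ (sum_norm D #|A| + e)).
      by rewrite addrA lerD2r; apply: (le_trans (lin _)); rewrite mulrDl mul1r [_ / _ * p]mulrAC [_%:R * p]mulrC [p * _ / _]mulrAC.
    by congr (normle _ _) : hh; apply/funext => i; apply: eq_bigl => l; exact: A'E.
  apply: (le_trans (@layers_upper R K' c g (sg \o k) (b \o k) h (p / t%:R) (p + e) n cg bk pt0 pe0 HA)).
  rewrite ler_pM2l ?invr_gt0//.
  have h1 : p / t%:R * h%:R <= 2 / 3 * P.
    by rewrite mulrAC [p * _]mulrC [h%:R * p * _]mulrAC.
  have h2 : p / t%:R <= p by rewrite ler_pdivrMr// ler_peMr// ler1n.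
  have h3 : (pieces K')%:R * (p / t%:R + (p + e)) <= (pieces K)%:R * (2 * p + e).
    apply: ler_pM => //; first by rewrite addr_ge0.
      by rewrite ler_nat leq_pieces.
    by rewrite addrA lerD2r mulrDl mul1r lerD2r.
  move: h1 h3 plen; rewrite [(pieces K)%:R * (2 * p + e)]mulrDr elen; lra.
- move=> hn; have [|_ h2] := HN k' hk'; first exact: leq_trans Tk'.
  have : P <= 98 / 100 * P + e.
    by apply: h2; apply: normle_dom hn => i; rewrite x12.
  by move: eP P0; lra.
exists c, g, n; split=> //.
under eq_bigr do rewrite mulrCA.
rewrite -mulr_sumr mulrC ler_pdivlMr//.
apply: le_trans v; move: P0; lra.
Qed.

End block_model_l1.

(** * A copy of l1 in every spreading model *)

Section block_model_contains_l1.
Context {R : realType} {Y : normedModType R}.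
Variables (D : nat -> Y) (sg : nat -> nat) (b : nat -> nat -> R).
Hypotheses (bB : blocks sg b) (sgl : forall l, (l <= sg l)%N).
Hypothesis model : block_model D b.
Hypothesis phi1 : 0 < sum_norm D 1.

Let b0 l t : 0 <= b l t. Proof. by have [_ /(_ l t)[]] := bB. Qed.

Definition offset (M : nat -> nat) (l : nat) : nat := (\sum_(i < l) M i)%N.

(** Combinations of successive blocks of [D] are combinations of [D]; the last
    clause says that the model sees the blocks with the same coefficients. *)
Lemma concat_coefs (M : nat -> nat) (c : nat -> R) (L : nat) :
  exists (a : nat -> R) (C : R), [/\ 0 < C, forall i, `|a i| <= C,
    \sum_(i < offset M L) a i *: D i =
      \sum_(l < L) c l *: \sum_(i < M l) D (offset M l + i) &
    forall F : nat -> R, \sum_(i < offset M L) `|a i| * F i =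
      \sum_(l < L) `|c l| * \sum_(i < M l) F (offset M l + i)%N].
Proof.
elim: L => [|L [a [C [C0 aC aD aF]]]].
  exists (fun=> 0), 1; split=> // [i||F]; rewrite ?normr0 ?ler01//.
    by rewrite /offset !big_ord0.
  by rewrite /offset !big_ord0.
have oS : offset M L.+1 = (offset M L + M L)%N by rewrite /offset big_ord_recr.
exists (fun i => if (i < offset M L)%N then a i else c L), (C + `|c L|); split.
- by rewrite ltr_wpDr.
- by move=> i; case: ifP => _; [rewrite (le_trans (aC i))// lerDl|rewrite lerDr ltW].
- rewrite oS big_split_ord/= [in RHS]big_ord_recr/= -aD scaler_sumr; congr (_ + _).
    by apply: eq_bigr => i _; rewrite ltn_ord.
  by apply: eq_bigr => i _; rewrite ltnNge leq_addr.
move=> F; rewrite oS big_split_ord/= [in RHS]big_ord_recr/= -aF mulr_sumr; congr (_ + _).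
  by apply: eq_bigr => i _; rewrite ltn_ord.
by apply: eq_bigr => i _; rewrite ltnNge leq_addr.
Qed.

(** The windows are chosen successively, each one starting where the previous one
    stops, so that their layers can be merged into one norming functional. *)
Lemma block_model_l1_like : exists u : nat -> Y, l1_like u 8^-1.
Proof.
have /choice[B /choice[M /choice[cf /choice[T HW]]]] := normed_window bB sgl model phi1.
pose Kq l := iter l B 0%N.
pose Ml l := M (Kq l); pose o := offset Ml; pose cl l := cf (Kq l).
exists (fun l => cl l *: \sum_(i < Ml l) D (o l + i)); split.
  move=> l; have [_ c0 c1 _] := HW (Kq l); rewrite normrZ gtr0_norm//.
  by apply: le_trans c1; rewrite ler_wpM2l ?(ltW c0)//; exact: (norm_shift_le bB model).
move=> n a; apply/ler_addgt0Pr => e e0.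
have [a' [C [C0 aC aD aF]]] := concat_coefs Ml (fun l => a l * cl l) n.
have [T0 H0] := model_bdd model (offset Ml n) e0 C0.
pose S := (T0 + Kq n + \sum_(l < n) T (Kq l))%N.
pose k i := (S + i)%N.
have hk : {homo k : i j / (i < j)%N} by move=> i j; rewrite ltn_add2l.
have [|h1 _] := H0 a' k aC hk.
  by rewrite /k /S addn0 -addnA leq_addr.
pose v l t := cl l * \sum_(i < Ml l) b (k (o l + i)%N) t.
have v0 l t : 0 <= v l t.
  by have [_ c0 _ _] := HW (Kq l); rewrite mulr_ge0 ?(ltW c0)// sumr_ge0.
pose x m t := \sum_(l < m) `|a l| * v l t.
have xn : normle (x n) (`|\sum_(l < n) a l *: (cl l *: \sum_(i < Ml l) D (o l + i))| + e).
  have eD : \sum_(l < n) a l *: (cl l *: \sum_(i < Ml l) D (o l + i)) = \sum_(i < o n) a' i *: D i.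
    by rewrite aD; apply: eq_bigr => l _; rewrite scalerA.
  rewrite eD; congr (normle _ _) : h1; apply/funext => t.
  rewrite (aF (fun i => b (k i) t)); apply: eq_bigr => l _.
  have [_ c0 _ _] := HW (Kq l).
  by rewrite normrM (gtr0_norm c0) -mulrA.
have merge m : (m <= n)%N -> exists c g q, admissible c g /\
    8^-1 * \sum_(l < m) `|a l| <= \sum_(t < q) layers 0 (Kq m) c g t * x m t.
  elim: m => [_|m IH mn].
    exists (fun _ _ => 0%N), (fun _ _ j => (j == 0%N)%:R), 0%N; split; first exact: admissible0.
    by rewrite !big_ord0 mulr0.
  have [c [g [q [cg h]]]] := IH (ltnW mn).
  have [KB c0 _ /(_ (fun i => k (o m + i)%N))] := HW (Kq m).
  have hk' : {homo (fun i => k (o m + i)%N) : i j / (i < j)%N}.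
    by move=> i j ij; apply: hk; rewrite ltn_add2l.
  have Tk' : (T (Kq m) <= k (o m + 0))%N.
    rewrite addn0 /k; apply: leq_trans (leq_addr _ _); rewrite /S.
    by apply: leq_trans (leq_addl _ _); rewrite (bigD1 (Ordinal mn))//= leq_addr.
  move=> /(_ hk' Tk')[c' [g' [q' [cg' h']]]].
  have [|c'' [g'' [cg'' E]]] := @layers_cat R 0 (Kq m) (Kq m.+1) c g c' g' cg cg'; first by rewrite leq0n.
  exists c'', g'', (maxn q q'); split=> //.
  have l0 l1 l2 d f t : admissible d f -> 0 <= layers l1 l2 d f t :> R.
    by move=> [_ Wf]; apply: layers_ge0 => *; exact: norming_ge0.
  have x0 l t : 0 <= x l t by apply: sumr_ge0 => *; rewrite mulr_ge0.
  apply: (@le_trans _ _ (\sum_(t < maxn q q') (layers 0 (Kq m) c g t * x m t +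
      `|a m| * (layers (Kq m) (Kq m.+1) c' g' t * v m t)))).
    rewrite big_split/= big_ord_recr/= mulrDr lerD//.
      apply: le_trans h _; apply: (@sum_nonneg_mono _ (fun t => layers 0 (Kq m) c g t * x m t)); last exact: leq_maxl.
      by move=> t; rewrite mulr_ge0// l0.
    rewrite -mulr_sumr mulrC ler_wpM2l//; apply: (le_trans h').
    apply: (@sum_nonneg_mono _ (fun t => layers (Kq m) (Kq m.+1) c' g' t * v m t)); last exact: leq_maxr.
    by move=> t; rewrite mulr_ge0// l0.
  apply: ler_sum => t _; rewrite E /x big_ord_recr/= -/(x m t).
  rewrite mulrCA mulrDl lerD// ler_wpM2l ?l0//.
    by rewrite lerDl mulr_ge0.
  by rewrite lerDr.
have [c [g [q [cg h]]]] := merge n (leqnn n).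
apply: (le_trans h).
have far t : x n t != 0 -> (Kq n <= t)%N.
  move=> xt; have [l vl] : exists l, v l t != 0.
    apply: contrapT => no; move: xt; rewrite /x big1 ?eqxx// => l _.
    have [->|vl] := eqVneq (v l t) 0; first by rewrite mulr0.
    by exfalso; apply: no; exists l.
  have [i bi] : exists i, b (k (o l + i)%N) t != 0.
    apply: contrapT => no; move: vl; rewrite /v big1 ?mulr0 ?eqxx// => i _.
    have [//|bi] := eqVneq (b (k (o l + i)%N) t) 0.
    by exfalso; apply: no; exists i.
  have [_ hb] := bB; have /andP[h2 _] := (hb _ _).2 bi.
  apply: leq_trans h2; apply: leq_trans (sgl _); rewrite /k /S.
  by rewrite -!addnA addnCA leq_addr.
have := layers_far_le 0 q cg far xn.
apply: le_trans; apply: ler_sum => t _.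
rewrite ger0_norm// sumr_ge0// => l _; by rewrite mulr_ge0.
Qed.

End block_model_contains_l1.

(** * Passing from a spreading model to blocks *)

Section extract_blocks.
Context {R : realType} {Z : normedModType R}.
Variables (x : nat -> mixed R) (z : nat -> Z) (Mx : R).

(** The defining estimate of a spreading model, with the error made independent of
    the number of terms by padding with zero coefficients. *)
Definition spreads := forall n (e : R), 0 < e -> exists T,
  forall (a : nat -> R) (k : nat -> nat), (forall i, `|a i| <= 1) ->
  {homo k : i j / (i < j)%N} -> (T <= k 0)%N ->
  `| `|\sum_(i < n) a i *: x (k i)| - `|\sum_(i < n) a i *: z i| | <= e.

Hypotheses (xz : spreads) (xM : forall l, `|x l| <= Mx).

Lemma sum_double (V : nmodType) n (F : nat -> V) :
  \sum_(i < n.*2) F i = \sum_(i < n) (F i.*2 + F i.*2.+1).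
Proof.
elim: n => [|n IH]; first by rewrite !big_ord0.
by rewrite doubleS !big_ord_recr/= IH addrA.
Qed.

(** Both sides are compared with the combination of far terms of [x], the indices
    outside the range of [k] receiving the coefficient 0. *)
Lemma spread_inv n (a : nat -> R) (k : nat -> nat) : (forall i, `|a i| <= 1) ->
  {homo k : i j / (i < j)%N} ->
  `|\sum_(i < n) a i *: z (k i)| = `|\sum_(i < n) a i *: z i|.
Proof.
move=> a1 hk; pose m := k n.
pose a' j := \sum_(i < n) (k i == j)%:R * a i.
have km (i : 'I_n) : (k i < m)%N by exact: hk.
have kinj i j : k i = k j -> i = j.
  move=> e; case: (ltngtP i j) => // /hk; by rewrite e ltnn.
have a'E (V : lmodType R) (F : nat -> V) : \sum_(j < m) a' j *: F j = \sum_(i < n) a i *: F (k i).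
  under eq_bigr do rewrite scaler_suml.
  rewrite exchange_big/=; apply: eq_bigr => i _.
  rewrite (bigD1 (Ordinal (km i)))//= eqxx mul1r big1 ?addr0// => j ji.
  rewrite (negbTE (_ : k i != j)) ?mul0r ?scale0r//.
  by apply: contraNN ji => /eqP e; apply/eqP/val_inj.
have a'1 j : `|a' j| <= 1.
  have [[i ij]|no] := pselect (exists i : 'I_n, k i = j); last first.
    rewrite /a' big1 ?normr0// => i _; case: eqP => [e|_]; last by rewrite mul0r.
    by exfalso; apply: no; exists i.
  rewrite /a' (bigD1 i)//= ij eqxx mul1r big1 ?addr0// => i' i'i.
  rewrite -ij (negbTE (_ : k i' != k i)) ?mul0r//.
  by apply: contraNN i'i => /eqP /kinj /val_inj ->.
apply/eqP; rewrite -subr_eq0 -normr_le0; apply/ler_addgt0Pl => e e0; rewrite addr0.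
have e20 : 0 < e / 2 by rewrite divr_gt0.
have [T1 H1] := xz m e20; have [T2 H2] := xz n e20.
pose s i := (T1 + T2 + i)%N.
have hs : {homo s : i j / (i < j)%N} by move=> i j; rewrite ltn_add2l.
have Ts1 : (T1 <= s 0)%N by rewrite /s addn0 leq_addr.
have Ts2 : (T2 <= (s \o k) 0)%N by rewrite /s /= -addnA addnCA leq_addr.
have hsk : {homo s \o k : i j / (i < j)%N} by move=> i j ij; exact/hs/hk.
have h1 := H1 a' s a'1 hs Ts1; have h2 := H2 a (s \o k) a1 hsk Ts2.
rewrite (a'E _ (fun i => x (s i))) (a'E _ z) in h1.
rewrite (splitr e); apply: le_trans (lerD h1 h2).
rewrite [X in _ <= X + _]distrC; apply: le_trans (ler_normD _ _).
by rewrite addrA subrK.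
Qed.

Definition pair_diff (l : nat) : Z := z l.*2 - z l.*2.+1.

Definition alternate (a : nat -> R) (m : nat) : R := if odd m then - a m./2 else a m./2.

Lemma alternate_sum (V : lmodType R) n (a : nat -> R) (F : nat -> V) :
  \sum_(i < n.*2) alternate a i *: F i = \sum_(l < n) a l *: (F l.*2 - F l.*2.+1).
Proof.
rewrite (sum_double n (fun i => alternate a i *: F i)); apply: eq_bigr => l _.
by rewrite /alternate /= odd_double/= doubleK uphalf_double scaleNr scalerBr.
Qed.

Lemma alternate_le1 (a : nat -> R) : (forall i, `|a i| <= 1) -> forall i, `|alternate a i| <= 1.
Proof. by move=> a1 i; rewrite /alternate; case: ifP => _; rewrite ?normrN. Qed.

Lemma norm_chain_sum (k : nat -> nat) N : {homo k : i j / (i < j)%N} ->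
  `|chain_sum z k N| = sum_norm pair_diff N.
Proof.
move=> hk; have one (i : nat) : `|(fun=> 1 : R) i| <= 1 by rewrite normr1.
have e1 : chain_sum z k N = \sum_(i < N.*2) alternate (fun=> 1) i *: z (k i).
  by rewrite (alternate_sum N (fun=> 1) (z \o k)); apply: eq_bigr => l _; rewrite scale1r.
rewrite e1 (spread_inv _ (@alternate_le1 (fun=> 1) one) hk) alternate_sum /sum_norm.
by congr `|_|; apply: eq_bigr => l _; rewrite scale1r.
Qed.

Lemma norm_sum_disjoint (I : finType) (h : I -> R) :
  (forall i j, h i != 0 -> h j != 0 -> i = j) -> `|\sum_i h i| = \sum_i `|h i|.
Proof.
move=> hd; have [[i0 hi]|no] := pselect (exists i, h i != 0); last first.
  have h0 i : h i = 0 by apply: contrapT => hi; apply: no; exists i; exact/eqP.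
  by rewrite !big1 ?normr0// => i _; rewrite h0 ?normr0.
rewrite (bigD1 i0)//= [in RHS](bigD1 i0)//= !big1 ?addr0// => i ii0.
  by have [->|hi'] := eqVneq (h i) 0; [rewrite normr0|rewrite (hd _ _ hi' hi) eqxx in ii0].
by have [//|hi'] := eqVneq (h i) 0; rewrite (hd _ _ hi' hi) eqxx in ii0.
Qed.

(** By the pigeonhole principle two terms nearly agree on the first coordinates, and
    the tail of their difference is small. *)
Lemma next_block l s m : exists p : nat * nat * nat,
  [/\ (s < p.2)%N, (m <= p.1.1)%N, (p.1.1 < p.1.2)%N &
  `|x p.1.1 - x p.1.2 - mixed_restr (fun t => s <= t < p.2)%N (x p.1.1 - x p.1.2)| <= l.+1%:R^-1].
Proof.
have d0 : 0 < l.+1%:R^-1 / 2 :> R by rewrite divr_gt0.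
set d := _ / 2 in d0.
have e0 : 0 < d / s.+1%:R by rewrite divr_gt0.
have [i [j [mi ij close]]] := close_pair s m e0
  (fun l t => le_trans (norm_mixed_coord (x l) t) (xM l)).
set w := x i - x j.
have [s' Hs'] := mixed_tail w d0.
exists (i, j, maxn s' s.+1); split=> //=; first exact: leq_maxr.
have head : `|mixed_restr (fun t => t < s)%N w| <= d.
  apply: norm_mixed_le => f n Wf.
  apply: (@le_trans _ _ (\sum_(t < n) (if (t < s)%N then d / s.+1%:R else 0))).
    apply: ler_sum => t _; rewrite mixed_restrE; case: ifP => ts; last first.
      by rewrite mul0r normr0 mulr0.
    rewrite mul1r; apply: (le_trans _ (close t ts)).
    by rewrite ler_piMl// norming_le1.
  pose F t := if (t < s)%N then d / s.+1%:R else 0.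
  have F0 t : 0 <= F t by rewrite /F; case: ifP => // _; exact: ltW.
  apply: (le_trans (sum_nonneg_mono F0 (leq_maxr s n))).
  rewrite /F -(@sum_pad _ s _ (fun=> d / s.+1%:R) (leq_maxl s n)).
  rewrite sumr_const card_ord -[leLHS]mulr_natr mulrAC ler_pdivrMr// ler_pM2l//.
  by rewrite ler_nat.
have tail : `|mixed_restr (leq (maxn s' s.+1)) w| <= d.
  apply: le_trans Hs'; apply: norm_mixed_dom => t; rewrite !mixed_restrE !normrM ler_wpM2r//.
  rewrite !normr_nat ler_nat geq_max; case: (s' <= t)%N => //=; exact: leq_b1.
rewrite [leRHS]splitr -/d; apply: le_trans (lerD head tail).
apply: le_trans (ler_normD _ _); apply: norm_mixed_dom => t.
rewrite le_eqVlt; apply/orP; left; apply/eqP; congr `|_|.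
transitivity (w t - (s <= t < maxn s' s.+1)%N%:R * w t); first by [].
transitivity ((t < s)%N%:R * w t + (maxn s' s.+1 <= t)%N%:R * w t); last by [].
have sS : (s < maxn s' s.+1)%N by exact: leq_maxr.
case: (ltnP t s) => ts.
  by rewrite (leqNgt _ t) (ltn_trans ts sS)/= mul0r mul1r subr0 addr0.
rewrite /= mul0r add0r; case: (ltnP t) => _; rewrite ?mul1r ?mul0r ?subrr//.
by rewrite subr0.
Qed.

(** The differences are replaced by their restrictions to successive intervals;
    the l-th error is at most 1 / (l + 1), so the error in a combination of
    n far terms vanishes.  By unconditionality only absolute values matter. *)
Lemma extract_blocks : exists sg b, [/\ blocks sg b, forall l, (l <= sg l)%N &
  block_model pair_diff b].
Proof.
have /choice[F0 HF0] (q : nat * nat * nat) := next_block q.1.1 q.1.2 q.2.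
pose F l (q : nat * nat) := F0 (l, q.1, q.2).
pose st := fix st l : nat * nat := if l is l'.+1 then
  ((F l' (st l')).2, ((F l' (st l')).1.2).+1) else (0%N, 0%N).
pose sg l := (st l).1; pose II l := (F l (st l)).1.1; pose J l := (F l (st l)).1.2.
have HF l : [/\ (sg l < sg l.+1)%N, (II l < J l)%N, (J l < II l.+1)%N &
    `|x (II l) - x (J l) - mixed_restr (fun t => sg l <= t < sg l.+1)%N (x (II l) - x (J l))| <= l.+1%:R^-1].
  have [h1 h2 h3 h4] := HF0 (l, (st l).1, (st l).2).
  by have [_ h5 _ _] := HF0 (l.+1, (st l.+1).1, (st l.+1).2); split.
pose c l := mixed_restr (fun t => sg l <= t < sg l.+1)%N (x (II l) - x (J l)).
pose b l t : R := `|c l t|.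
have hsg : {homo sg : i j / (i <= j)%N}.
  by apply: homo_leq => [//||l]; [exact: leq_trans|apply: ltnW; have [] := HF l].
have sgl l : (l <= sg l)%N by elim: l => // l IH; have [h _ _ _] := HF l; exact: leq_ltn_trans h.
have cs l t : c l t != 0 -> (sg l <= t < sg l.+1)%N.
  by rewrite mixed_restrE; case: (_ <= t < _)%N => //; rewrite mul0r eqxx.
have bB : blocks sg b.
  by split=> // l t; split; [exact: normr_ge0|rewrite normr_eq0; exact: cs].
exists sg, b; split=> // n e e0.
have e20 : 0 < e / 2 by rewrite divr_gt0.
have [T HT] := xz n.*2 e20.
pose T' := Num.truncn (n%:R / (e / 2)).
have HT' : n%:R / (e / 2) < T'.+1%:R by rewrite truncnS_gt.
exists (maxn T T') => a k a1 hk; rewrite geq_max => /andP[Tk T'k].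
pose kap m := if odd m then J (k m./2) else II (k m./2).
have IJ l l' : (l < l')%N -> (J l < II l')%N.
  elim: l' => // l' IH; rewrite ltnS leq_eqVlt => /orP[/eqP->|/IH h]; first by have [] := HF l'.
  have [_ h1 h2 _] := HF l'; exact: ltn_trans h (ltn_trans h1 h2).
have hkap : {homo kap : i j / (i < j)%N}.
  apply: homo_ltn; first exact: ltn_trans.
  move=> m; rewrite /kap /= uphalf_half; case: (odd m) => /=.
    by apply/IJ/hk; rewrite add1n.
  by rewrite add0n; have [] := HF (k m./2).
have III l : (l <= II l)%N.
  elim: l => // l IH; have [_ h1 h2 _] := HF l.
  by apply: leq_trans h2; apply: (leq_trans IH); exact: ltnW.
have Tkap : (T <= kap 0)%N by rewrite /kap /=; exact: leq_trans (III _).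
have := HT (alternate a) kap (alternate_le1 a1) hkap Tkap.
rewrite !alternate_sum.
pose w := \sum_(l < n) a l *: (x (II (k l)) - x (J (k l))).
have -> : \sum_(i < n.*2) alternate a i *: x (kap i) = w.
  rewrite (alternate_sum n a (x \o kap)); apply: eq_bigr => l _.
  by rewrite /kap /= odd_double/= doubleK uphalf_double.
pose w' := \sum_(l < n) a l *: c (k l).
have ww' : `|w - w'| <= e / 2.
  rewrite /w /w' -sumrB; apply: (le_trans (ler_norm_sum _ _ _)).
  apply: (@le_trans _ _ (\sum_(l < n) (T'.+1%:R^-1))).
    apply: ler_sum => l _; rewrite -scalerBr normrZ.
    have [_ _ _ h] := HF (k l); apply: (le_trans (ler_piMl _ (a1 l))) => //.
    apply: (le_trans h); rewrite lef_pV2 ?posrE ?ltr0n// ler_nat ltnS.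
    by apply: (leq_trans T'k); exact: (ltnW_homo hk).
  rewrite sumr_const card_ord -[leLHS]mulr_natl ler_pdivrMr ?ltr0n// mulrC -ler_pdivrMr//.
  exact: ltW.
have w'E t : `|w' t| = `|\sum_(l < n) `|a l| * b (k l) t|.
  rewrite [RHS]ger0_norm; last by apply: sumr_ge0 => l _; exact: mulr_ge0 (normr_ge0 _) (normr_ge0 _).
  rewrite /w' mixed_sum.
  rewrite (norm_sum_disjoint (h := fun l : 'I_n => a l * c (k l) t)).
    by apply: eq_bigr => l _; rewrite normrM.
  move=> i j; rewrite (mulf_eq0 (a i)) (mulf_eq0 (a j)) !negb_or => /andP[_ ci] /andP[_ cj].
  have /andP[i1 i2] := cs _ _ ci; have /andP[j1 j2] := cs _ _ cj.
  case: (ltngtP i j) => [ij|ji|/val_inj//].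
    by have := leq_trans i2 (leq_trans (hsg _ _ (hk _ _ ij)) j1); rewrite ltnn.
  by have := leq_trans j2 (leq_trans (hsg _ _ (hk _ _ ji)) i1); rewrite ltnn.
have wle r : normle (fun t => \sum_(l < n) `|a l| * b (k l) t) r <-> `|w'| <= r.
  rewrite -normle_mixedP; split; apply: normle_dom => t; by rewrite w'E.
rewrite -/pair_diff; set E := `|\sum_(i < n) a i *: _ |; move=> hwE.
have h1 : `|w| <= `|w'| + e / 2.
  have := ler_normD w' (w - w'); rewrite [w' + _]addrC subrK => /le_trans; apply.
  by rewrite lerD2l.
have h2 : `|w'| <= `|w| + e / 2.
  have := ler_normB w (w - w'); rewrite opprB [w + (w' - w)]addrC subrK => /le_trans; apply.
  by rewrite lerD2l.
have {}hwE : `|w| <= E + e / 2 /\ E <= `|w| + e / 2.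
  by move: hwE; rewrite ler_norml => /andP[]; split; lra.
split; first by apply/wle; rewrite -/E; lra.
by move=> r /wle; rewrite -/E; lra.
Qed.

End extract_blocks.

(** * Isomorphism types of the spreading models *)

Section spreading_models.
Context {R : realType}.

Lemma linear_bound (X Y : normedModType R) (T : {linear X -> Y}) : continuous T ->
  exists C : R, 0 < C /\ forall v, `|T v| <= C * `|v|.
Proof.
move=> /linear_bounded_continuous /linear_boundedP[M [_ HM]].
exists (`|M| + 1); split; first by rewrite ltr_wpDl.
by move=> v; apply: HM; rewrite (le_lt_trans (ler_norm _))// ltrDl.
Qed.

Section lift.
Context {Y : normedModType R} (y : nat -> Y).

Lemma lin_span_term n : lin_span y (y n).
Proof.
exists n.+1, (fun i => (i == n)%:R); rewrite big_ord_recr/= eqxx scale1r big1 ?add0r// => i _.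
by rewrite ltn_eqF ?ltn_ord// scale0r.
Qed.

Lemma in_closed_span_term n : y n \in in_closed_span y.
Proof. by apply/asboolP/subset_closure; exact: lin_span_term. Qed.

Definition span_term n : closed_span y := ClosedSpan (in_closed_span_term n).

Lemma norm_span_term_sum n (a : nat -> R) :
  `|\sum_(i < n) a i *: span_term i| = `|\sum_(i < n) a i *: y i|.
Proof.
suff -> : \sum_(i < n) a i *: y i = val (\sum_(i < n) a i *: span_term i) by [].
by rewrite raddf_sum; apply: eq_bigr => i _.
Qed.

Lemma generates_spreads (x : nat -> mixed R) :
  generates_spreading_model x y -> spreads x span_term.
Proof.
move=> [_ _ [eps [_ eps0 Heps]]] n e e0.
have [N _ HN] := (@cvgrPdist_lt _ _ _ _ _ _ _).1 eps0 e e0.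
pose n' := (n + N).+1.
have epsn : eps n' < e.
  have := HN n'; rewrite /= sub0r normrN => /(_ _)/(le_lt_trans (ler_norm _)); apply.
  exact: leqW (leq_addl n N).
exists n' => a k a1 hk nk.
pose a' i := if (i < n)%N then a i else 0.
have a'1 i : `|a' i| <= 1 by rewrite /a'; case: ifP; rewrite ?normr0.
have pad (V : lmodType R) (F : nat -> V) : \sum_(i < n) a i *: F i = \sum_(i < n') a' i *: F i.
  rewrite (@sum_pad _ n n' (fun i => a i *: F i)); last exact: leqW (leq_addr N n).
  by apply: eq_bigr => i _; rewrite /a'; case: ifP; rewrite ?scale0r.
rewrite norm_span_term_sum (pad _ y) (pad _ (x \o k)).
have := Heps n' (fun i => a' i) (fun i => k i) isT.
have h1 (i : 'I_n') : -1 <= a' i <= 1 by rewrite -ler_norml.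
have h2 (i : 'I_n') : (n' <= (k i).+1)%N.
  by rewrite leqW// (leq_trans nk)//; exact: (ltnW_homo hk).
have h3 : {homo (fun i : 'I_n' => k i) : i j / (i < j)%O >-> (i < j)%N} by move=> i j; exact: hk.
move=> /(_ h1 h2); move=> /(_ h3) /ltW /le_trans; apply; exact: ltW.
Qed.

(** Uniqueness of the expansion of the common value. *)
Lemma basic_sequence_neq01 : basic_sequence y -> y 0 != y 1.
Proof.
move=> [yV yu]; apply/eqP => y01.
have single m : series (fun n => (n == m)%:R *: y n : Y) @ \oo --> y m.
  apply: cvg_near_cst; exists m.+1 => // n /= mn.
  rewrite /series/= big_mkord (bigD1 (Ordinal mn))//= eqxx scale1r big1 ?addr0// => i im.
  by rewrite (negbTE (_ : (i : nat) != m)) ?scale0r.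
have [a [_ au]] := yu (y 0) (yV 0%N).
have e0 := au (fun n => (n == 0)%:R) (single 0%N).
have e1 := au (fun n => (n == 1)%:R).
rewrite y01 in e1; have {}e1 := e1 (single 1%N).
have := congr1 (fun f => f 0%N) (etrans (esym e0) e1) => /eqP.
by rewrite /= oner_eq0.
Qed.

End lift.

(** An isomorphism onto c0 would bound alternating sums, contradicting
    [sum_norm_pieces_ge]; an isomorphism onto l1 would make them grow linearly,
    contradicting [sum_norm_sublinear]. *)
Theorem spreading_models (x : nat -> mixed R) (Y : completeNormedModType R) (y : nat -> Y) :
  normalized x -> generates_spreading_model x y ->
  [/\ ~ isomorphic (closed_span y) (c0 R), ~ isomorphic (closed_span y) (l1 R) &
      ~ reflexive_space (closed_span y)].
Proof.
move=> x1 xy; have [_ yb _] := xy.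
pose z := span_term y.
have xz : spreads x z := generates_spreads xy.
have x1l l : `|x l| <= 1 by rewrite x1.
have [sg [b [bB sgl model]]] := extract_blocks xz x1l.
have phi1E i j : (i < j)%N -> `|z i - z j| = sum_norm (pair_diff z) 1.
  move=> ij.
  have hk : {homo (fun t => if t is t'.+1 then (j + t')%N else i) : s t / (s < t)%N}.
    apply: homo_ltn => [|[|t]]; first exact: ltn_trans.
      by rewrite addn0.
    by rewrite addnS.
  by rewrite -(norm_chain_sum xz 1 hk) /chain_sum big_ord1 addn0.
have phi1 : 0 < sum_norm (pair_diff z) 1.
  rewrite -(phi1E 0 1 isT) normr_gt0 subr_eq0; apply: contraNneq (basic_sequence_neq01 yb).
  by move=> /(congr1 val) /= ->.
have zb l : `|z l| = `|z 0|.
  have one (i : nat) : `|(fun=> 1 : R) i| <= 1 by rewrite normr1.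
  have := spread_inv xz 1 one (_ : {homo addn l : i j / (i < j)%N}).
  rewrite !big_ord1 addn0 !scale1r; apply.
  by move=> i j; rewrite ltn_add2l.
have lin_chain (V : normedModType R) (T : {linear closed_span y -> V}) k N :
    T (chain_sum z k N) = chain_sum (T \o z) k N.
  by rewrite raddf_sum; apply: eq_bigr => l _; rewrite raddfB.
split.
- move=> [T [S [cT cS TS ST]]].
  have [CT [CT0 HT]] := linear_bound cT; have [CS [CS0 HS]] := linear_bound cS.
  pose M := CT * `|z 0|.
  have uM l : `|(T \o z) l| <= M by rewrite (le_trans (HT _))// zb.
  have [K HK] := weight_pieces_unbounded (CS * (2 * M + 1) / sum_norm (pair_diff z) 1).
  have [k [hk kM]] := c0_chain uM (pieces K).
  have := sum_norm_pieces_ge bB sgl model K; rewrite leNgt => /negP[].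
  rewrite -(norm_chain_sum xz (pieces K) hk) -[chain_sum z k (pieces K)]TS lin_chain.
  apply: (le_lt_trans (HS _)); rewrite ltr_pdivrMr// in HK.
  by apply: lt_trans HK; rewrite ltr_pM2l.
- move=> [T [S [cT cS TS ST]]].
  have [CT [CT0 HT]] := linear_bound cT; have [CS [CS0 HS]] := linear_bound cS.
  pose M := CT * `|z 0|.
  have uM l : `|(T \o z) l| <= M by rewrite (le_trans (HT _))// zb.
  pose d := sum_norm (pair_diff z) 1 / CS / 2.
  have d0 : 0 < d by rewrite !divr_gt0.
  have ud i j : (i < j)%N -> 2 * d <= `|(T \o z) i - (T \o z) j|.
    move=> ij; rewrite /d mulrC divfK// ler_pdivrMr// mulrC -(phi1E i j ij).
    by rewrite -[z i - z j]TS raddfB.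
  have [n [n0]] := sum_norm_sublinear bB sgl model (divr_gt0 d0 CT0).
  have [k [hk kM]] := l1_chain d0 uM ud n.
  rewrite mulrAC ltr_pdivlMr// ltNge => /negP[]; apply: (le_trans kM).
  by rewrite -lin_chain -(norm_chain_sum xz n hk) mulrC.
- move=> refl; have [u ul] := block_model_l1_like bB sgl model phi1.
  by apply: (reflexive_no_l1 refl _ ul).
Qed.

End spreading_models.

Theorem theorem2p1 (R : realType) :
  exists X : completeNormedModType R,
    [/\ infinite_dimensional X,
        reflexive_space X,
        exists e : nat -> X, unconditional_basis e &
        forall x : nat -> X, normalized x -> basic_sequence x ->
        forall (Y : completeNormedModType R) (y : nat -> Y),
          generates_spreading_model x y ->
          [/\ ~ isomorphic (closed_span y) (c0 R),
              ~ isomorphic (closed_span y) (l1 R) &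
              ~ reflexive_space (closed_span y)]].
Proof.
exists (mixed R); split.
- exact: mixed_infinite_dimensional.
- exact: mixed_reflexive.
- by exists (mbasis R); exact: mbasis_unconditional.
- by move=> x x1 _ Y y xy; exact: spreading_models x1 xy.
Qed.
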